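(* Let $H$ be a fixed graph on $k$ vertices that admits a nice coloring. There is a combinatorial (randomized) algorithm that, given an $n$-vertex graph $G$ and a value $t$ that upper bounds the number of copies of $H$ in $G$, decides whether $G$ contains a triangle, in time $\tilde O\big(n^{3-\frac{1}{2^{k-1}}}+n^{3-\frac{k}{2^k-1}}\cdot t^{\frac{1}{2^k-1}}\big)$ if $H$ is triangle-free, and $\tilde O\big(n^{3-\frac{1}{2^{k-4}}}+n^{3-\frac{k-3}{2^{k-3}-1}}\cdot t^{\frac{1}{2^{k-3}-1}}\big)$ if $H$ contains a triangle. The algorithm succeeds with probability $1-O(1/n)$.
   Context: A copy of $H$ in $G$ is an injective map $\phi:V(H)\to V(G)$ with $\phi(x)\phi(y)\in E(G)$ for all $xy\in E(H)$; the number of copies is the number of such maps. A proper $3$-coloring of $H$ is nice if, by repeatedly deleting vertices whose neighborhood is monochromatic until none remain, the leftover graph is empty or a triangle. A ''combinatorial'' algorithm does not use fast matrix multiplication. $\tilde O$ hides polylogarithmic factors in $n$; $k$ is a constant. *)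

(* Defs.v *)
From HB Require Import structures.
From mathcomp Require Import all_boot all_order all_algebra.
From mathcomp Require Import reals exp.

Set Implicit Arguments.
Unset Strict Implicit.
Unset Printing Implicit Defensive.

Import Order.TTheory GRing.Theory Num.Theory.

Local Open Scope ring_scope.

Record sgraph := SGraph {
  vertex :> finType;
  adj : rel vertex;
  adj_sym : symmetric adj;
  adj_irr : irreflexive adj }.

Definition has_triangle (G : sgraph) : bool :=
  [exists x : G, exists y : G, exists z : G, [&& adj x y, adj y z & adj x z]].

Definition is_copy (H G : sgraph) (f : {ffun H -> G}) : bool :=
  injectiveb f && [forall x, forall y, adj x y ==> adj (f x) (f y)].

Definition num_copies (H G : sgraph) : nat :=
  #|[set f : {ffun H -> G} | is_copy f]|.

Section Nice.

Variables (H : sgraph) (col : H -> 'I_3).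

Definition proper_coloring : Prop := forall x y : H, adj x y -> col x != col y.

(* The neighborhood is taken in the graph induced on the vertices S not yet
   deleted; an empty neighborhood is monochromatic. *)
Definition deletable (S : {set H}) (x : H) : bool :=
  (x \in S) &&
  [forall y in S, forall z in S, adj x y ==> adj x z ==> (col y == col z)].

Inductive deletes_to : {set H} -> {set H} -> Prop :=
| deletes_refl S : deletes_to S S
| deletes_step S T x : deletable S x -> deletes_to (S :\ x) T -> deletes_to S T.

Definition induces_triangle (S : {set H}) : bool :=
  (#|S| == 3) && [forall x in S, forall y in S, (x != y) ==> adj x y].

(* A vertex that can be deleted stays deletable when other vertices are
   deleted, so the leftover S does not depend on the order of deletions. *)
Definition nice_coloring : Prop :=
  proper_coloring /\
  exists S : {set H},
    [/\ deletes_to [set: H] S,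
        forall x, ~~ deletable S x
      & S = set0 \/ induces_triangle S].

End Nice.

Definition has_nice_coloring (H : sgraph) : Prop :=
  exists col : H -> 'I_3, nice_coloring col.

Definition dist (A : Type) := seq (rat * A).

Definition dret A (a : A) : dist A := [:: (1, a)].

Definition dunif A (s : seq A) : dist A := [seq ((size s)%:R^-1, a) | a <- s].

Definition dbind A B (d : dist A) (f : A -> dist B) : dist B :=
  flatten [seq [seq (p.1 * q.1, q.2) | q <- f p.2] | p <- d].

Definition dprob A (d : dist A) (P : pred A) : rat := \sum_(p <- d | P p.2) p.1.

(* Combinatorial randomized algorithms.

   "Combinatorial" has no accepted formal definition: on an unrestricted random
   access machine fast matrix multiplication is just another program. The
   programs below are a class of algorithms from which it is absent by
   construction. A program works on a fixed finite number of registers, each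
   holding a natural number, a vertex or a set of vertices. There are no arrays,
   no tables indexed by numbers, vertices or pairs of vertices, and vertices
   are opaque: they are obtained only by sampling from a set, and inspected only
   by equality, membership and adjacency tests. The store therefore cannot hold
   a matrix, while neighborhoods, sampling, counting and exhaustive search are
   all available.

   A random access machine simulates a program within polylogarithmic factors:
   arithmetic is charged by bit length (with the cost of schoolbook
   multiplication, so that nothing is gained by packing data into long numbers),
   and a set stored as an array of its elements together with the position of
   each vertex supports the remaining operations at the cost charged. *)

Inductive arith := Add | Sub | Mul | Div.

Definition arith_op (o : arith) : nat -> nat -> nat :=
  match o with Add => addn | Sub => subn | Mul => muln | Div => divn end.

Inductive instr :=
| NumConst of nat & nat
| NumOp of arith & nat & nat & nat
| NumCoin of nat
| NumCard of nat & nat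
| VtxCopy of nat & nat
| VtxPick of nat & nat
| SetCopy of nat & nat
| SetAdd of nat & nat
| SetDel of nat & nat.

Inductive test :=
| NumLe of nat & nat
| VtxEq of nat & nat
| VtxAdj of nat & nat
| VtxIn of nat & nat.

Inductive program :=
| Skip
| Do of instr
| Seq of program & program
| If of test & program & program
| While of test & program.

Section Semantics.

Variable G : sgraph.

Record store := Store {
  num : nat -> nat;
  vtx : nat -> option G;
  vset : nat -> {set G};
  clock : nat }.

Definition bits (n : nat) : nat := (trunc_log 2 n).+1.

Definition tick (k : nat) (s : store) : store :=
  Store (num s) (vtx s) (vset s) (clock s + k).

Definition set_num (x a : nat) (s : store) : store :=
  Store [eta num s with x |-> a] (vtx s) (vset s) (clock s).

Definition set_vtx (v : nat) (a : option G) (s : store) : store :=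
  Store (num s) [eta vtx s with v |-> a] (vset s) (clock s).

Definition set_vset (A : nat) (X : {set G}) (s : store) : store :=
  Store (num s) (vtx s) [eta vset s with A |-> X] (clock s).

Definition instr_cost (i : instr) (s : store) : nat :=
  match i with
  | NumConst _ a => bits a
  | NumOp _ _ y z => bits (num s y) * bits (num s z)
  | NumCard _ A => bits #|vset s A|
  | SetCopy A B => (#|vset s A| + #|vset s B|).+1
  | _ => 1
  end.

(* The destination register comes first. Picking from an empty set, and adding
   or deleting an unset vertex, have no effect. *)
Definition instr_effect (i : instr) (s : store) : dist store :=
  match i with
  | NumConst x a => dret (set_num x a s)
  | NumOp o x y z => dret (set_num x (arith_op o (num s y) (num s z)) s)
  | NumCoin x => dunif [:: set_num x 0 s; set_num x 1 s]
  | NumCard x A => dret (set_num x #|vset s A| s)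
  | VtxCopy v w => dret (set_vtx v (vtx s w) s)
  | VtxPick v A =>
      if vset s A == set0 then dret s
      else dunif [seq set_vtx v (Some a) s | a <- enum (vset s A)]
  | SetCopy A B => dret (set_vset A (vset s B) s)
  | SetAdd A v =>
      dret (if vtx s v is Some a then set_vset A (a |: vset s A) s else s)
  | SetDel A v =>
      dret (if vtx s v is Some a then set_vset A (vset s A :\ a) s else s)
  end.

Definition test_cost (b : test) (s : store) : nat :=
  if b is NumLe x y then bits (num s x) * bits (num s y) else 1.

Definition test_value (b : test) (s : store) : bool :=
  match b with
  | NumLe x y => (num s x <= num s y)%N
  | VtxEq v w => vtx s v == vtx s w
  | VtxAdj v w =>
      if (vtx s v, vtx s w) is (Some a, Some b) then adj a b else false
  | VtxIn v A => if vtx s v is Some a then a \in vset s A else false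
  end.

(* The fuel only makes the recursion well-founded, and None means that it ran
   out: running time is measured by the clock, and once no outcome is None, more
   fuel does not change the distribution. *)
Fixpoint exec (fuel : nat) (p : program) (s : store) : dist (option store) :=
  if fuel is fuel'.+1 then
    match p with
    | Skip => dret (Some s)
    | Do i => dbind (instr_effect i (tick (instr_cost i s) s))
                    (fun s' => dret (Some s'))
    | Seq p1 p2 =>
        dbind (exec fuel' p1 s)
              (fun o => if o is Some s' then exec fuel' p2 s' else dret None)
    | If b p1 p2 =>
        exec fuel' (if test_value b s then p1 else p2) (tick (test_cost b s) s)
    | While b p1 =>
        exec fuel' (if test_value b s then Seq p1 (While b p1) else Skip)
             (tick (test_cost b s) s)
    end
  else dret None.

(* Input: t in number register 0 and the vertex set of G in set register 0. *)
Definition init_store (t : nat) : store :=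
  Store [eta (fun _ => 0%N) with 0%N |-> t] (fun _ => None)
        [eta (fun _ => set0) with 0%N |-> [set: G]] 0.

(* Output: number register 1, nonzero meaning "yes". *)
Definition answer (s : store) : bool := num s 1 != 0%N.

Definition decides_triangle (R : realType) (p : program) (t : nat) (T : R)
    (err : rat) : Prop :=
  exists fuel : nat,
    let d := exec fuel p (init_store t) in
    all (fun o => if o.2 is Some s then (clock s)%:R <= T else false) d /\
    1 - err <= dprob d (fun o =>
      if o is Some s then answer s == has_triangle G else false).

End Semantics.

Definition time_triangle_free (R : realType) (k n t : R) : R :=
  n `^ (3 - 1 / 2 `^ (k - 1))
  + n `^ (3 - k / (2 `^ k - 1)) * t `^ (1 / (2 `^ k - 1)).

(* For k = 3 the second exponent is 0/0 on paper; as x / 0 = 0 here, the bound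
   is then n + n^3. *)
Definition time_triangle (R : realType) (k n t : R) : R :=
  n `^ (3 - 1 / 2 `^ (k - 4))
  + n `^ (3 - (k - 3) / (2 `^ (k - 3) - 1)) * t `^ (1 / (2 `^ (k - 3) - 1)).

Definition time_bound (R : realType) (H : sgraph) (n t : nat) : R :=
  if has_triangle H then time_triangle #|H|%:R n%:R t%:R
  else time_triangle_free #|H|%:R n%:R t%:R.

(* Main.v *)
(* Let x_1, ..., x_k be the deleted vertices of H in order, x_i having color
   alpha_i and its neighbors among the remaining vertices color beta_i. The
   algorithm keeps three sets S_0, S_1, S_2 of vertices, initially all of V(G),
   and looks for a triangle with its vertex of color c in S_c. At step i it
   examines exhaustively every b in S_beta_i with at most 5 n / q_i neighbors in
   S_alpha_i. Then it samples v in S_alpha_i about q_i log n times; for each it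
   recurses after replacing S_beta_i by its intersection with N(v) and deleting v
   from the other two sets.

   Fix a triangle. A sequence v_1, ..., v_k that never removes its vertices is a
   copy of H, or of H without its leftover triangle, for which the fixed one
   stands in: later images of neighbors of x_i lie in N(v_i). If the triangle escaped the exhaustive search along enough
   sequences, there would be at least the product of the n / q_i of them, which
   is more than t. Hence at each step all but n / q_i of the choices of v_i that
   keep the triangle are good, a sample is good with probability at least
   1 / q_i, and the failure probability stays below 1 / n.

   With q_i = M ^ (2 ^ (i - 1)) every step costs n ^ 3 / M in total, up to
   logarithmic factors. The constraints q_k <= n and
   t * M ^ (2 ^ k - 1) < n ^ k on M give the two terms of the time bound. *)

Require Import Defs.
From HB Require Import structures.
From mathcomp Require Import all_boot all_order all_algebra.
From mathcomp Require Import reals exp sequences.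
From mathcomp Require Import zify ring lra.

Set Implicit Arguments.
Unset Strict Implicit.
Unset Printing Implicit Defensive.

Import Order.TTheory GRing.Theory Num.Theory.

Local Open Scope ring_scope.

(** * Program logic *)

Section ProgramLogic.

Variable G : sgraph.
Local Open Scope nat_scope.
Implicit Types (s : store G) (p : program) (B : nat) (r : rat) (Q : store G -> Prop).

Notation Forall := List.Forall.

Definition some_dist A (d : dist A) : dist (option A) := [seq (q.1, Some q.2) | q <- d].

Definition mass A (d : dist A) : rat := (\sum_(q <- d) q.1)%R.

Definition fail (d : dist (store G)) : rat := (\sum_(q <- d | ~~ answer q.2) q.1)%R.

(* Run from [s] with enough fuel, [p] halts on every outcome, within [B] units
   of time and in a store satisfying [Q]; the answer is "no" with probability at
   most [r]. With [r = 1] this is a plain Hoare triple. *)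
Definition ok p s B r Q : Prop :=
  exists (f : nat) (d : dist (store G)),
    [/\ forall f', f <= f' -> exec f' p s = some_dist d,
        Forall (fun q => [/\ (0 <= q.1)%R, clock q.2 <= clock s + B & Q q.2]) d,
        mass d = 1%R & (fail d <= r)%R].

Lemma mass_cat A (d e : dist A) : (mass (d ++ e) = mass d + mass e)%R.
Proof. exact: big_cat. Qed.

Lemma fail_cat d e : (fail (d ++ e) = fail d + fail e)%R.
Proof. exact: big_cat. Qed.

Definition scale A (w : rat) (d : dist A) : dist A := [seq ((w * q.1)%R, q.2) | q <- d].

Lemma mass_scale A w (d : dist A) : (mass (scale w d) = w * mass d)%R.
Proof. by rewrite /mass /scale big_map mulr_sumr. Qed.

Lemma fail_scale w d : (fail (scale w d) = w * fail d)%R.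
Proof. by rewrite /fail /scale big_map mulr_sumr. Qed.

Lemma dbind_cons A T w (a : A) d (F : A -> dist T) :
  dbind ((w, a) :: d) F = scale w (F a) ++ dbind d F.
Proof. by []. Qed.

Lemma some_dist_cat A (d e : dist A) : some_dist (d ++ e) = some_dist d ++ some_dist e.
Proof. exact: map_cat. Qed.

Lemma some_dist_scale A w (d : dist A) : scale w (some_dist d) = some_dist (scale w d).
Proof. by rewrite /scale /some_dist -!map_comp. Qed.

Lemma exec_doE f i s :
  exec f.+1 (Do i) s = some_dist (instr_effect i (tick (instr_cost i s) s)).
Proof.
rewrite /= /dbind; elim: (instr_effect _ _) => //= -[w a] d ->.
by rewrite /= mulr1.
Qed.

Lemma ok_bind p1 p2 s d1 B1 B (R : store G -> rat) Q f1 :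
  (forall f', f1 <= f' -> exec f' p1 s = some_dist d1) ->
  Forall (fun q => [/\ (0 <= q.1)%R, clock q.2 <= clock s + B1 &
                       ok p2 q.2 B (R q.2) Q]) d1 ->
  mass d1 = 1%R ->
  ok (Seq p1 p2) s (B1 + B) (\sum_(q <- d1) q.1 * R q.2)%R Q.
Proof.
move=> E1 F1 M1.
suff [f [d [Ed Fd Md Ld]]] : exists f d,
    [/\ forall f', f <= f' -> dbind (some_dist d1) (fun o =>
          if o is Some s' then exec f' p2 s' else dret None) = some_dist d,
        Forall (fun q => [/\ (0 <= q.1)%R, clock q.2 <= clock s + (B1 + B) & Q q.2]) d,
        mass d = mass d1 & (fail d <= \sum_(q <- d1) q.1 * R q.2)%R].
  exists (maxn f1 f).+1, d; split=> //; last by rewrite Md M1.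
  by case=> [//|f'] le /=; rewrite E1 ?Ed //; lia.
elim: d1 F1 {E1 M1} => [_|[w a] d1 IH FF].
  by exists 0, [::]; split=> //; rewrite ?/fail ?big_nil.
have [/= w0 ca [f2 [d2 [E2 F2 M2 L2]]]] := List.Forall_inv FF.
have [f [d [Ed Fd Md Ld]]] := IH (List.Forall_inv_tail FF).
exists (maxn f2 f), (scale w d2 ++ d); split.
- move=> f' le; rewrite /= dbind_cons E2 ?Ed; try lia.
  by rewrite some_dist_scale -some_dist_cat.
- apply/List.Forall_app; split=> //.
  elim: d2 F2 {E2 M2 L2} => [_|[u b] d2 IH2 FF2]; first exact: List.Forall_nil.
  have [/= u0 cb Qb] := List.Forall_inv FF2.
  constructor; last exact: IH2 (List.Forall_inv_tail FF2).
  by split=> //=; [rewrite mulr_ge0 | lia].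
- by rewrite mass_cat mass_scale Md M2 mulr1 /mass big_cons.
- rewrite fail_cat fail_scale big_cons lerD //.
  by rewrite ler_wpM2l.
Qed.

Lemma ok_weaken p s B B' r r' Q Q' :
  ok p s B r Q -> B <= B' -> (r <= r')%R -> (forall s', Q s' -> Q' s') ->
  ok p s B' r' Q'.
Proof.
move=> [f [d [E F M L]]] lB lr QQ; exists f, d; split=> //; last exact: le_trans lr.
by apply: List.Forall_impl F => q [? ? /QQ]; split=> //; lia.
Qed.

Lemma ok_le p s B B' r r' Q : ok p s B r Q -> B <= B' -> (r <= r')%R -> ok p s B' r' Q.
Proof. by move=> H lB lr; apply: ok_weaken H _ _ _. Qed.

Lemma ok_post p s B r Q Q' : ok p s B r Q -> (forall s', Q s' -> Q' s') -> ok p s B r Q'.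
Proof. by move=> H; apply: ok_weaken H _ _. Qed.

Lemma ok_sure p s B r Q :
  ok p s B r Q -> (forall s', Q s' -> answer s') -> ok p s B 0%R Q.
Proof.
move=> [f [d [E F M L]]] QA; exists f, d; split=> //.
rewrite /fail; elim: d F {E M L} => [_|q d IH F]; first by rewrite big_nil.
have [_ _ /QA an] := List.Forall_inv F.
by rewrite big_cons an /=; exact: IH (List.Forall_inv_tail F).
Qed.

Lemma ok_skip s Q : Q s -> ok Skip s 0 1%R Q.
Proof.
move=> Qs; exists 1, [:: (1%R, s)]; split=> //.
- by case.
- by constructor=> //; rewrite addn0.
- by rewrite /mass big_seq1.
- by rewrite /fail big_mkcond big_seq1; case: ifP.
Qed.

Lemma ok_det i s s' Q c :
  instr_effect i (tick (instr_cost i s) s) = dret s' ->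
  clock s' = clock s + instr_cost i s -> instr_cost i s <= c ->
  Q s' -> ok (Do i) s c 1%R Q.
Proof.
move=> Ei cl ci Qs'; exists 1, [:: (1%R, s')]; split=> //.
- by case=> // f _; rewrite exec_doE Ei.
- by constructor=> //; split=> //=; lia.
- by rewrite /mass big_seq1.
- by rewrite /fail big_mkcond big_seq1; case: ifP.
Qed.

Lemma sum_fail d r :
  (\sum_(q <- d) q.1 * (if answer q.2 then 0 else r) = fail d * r)%R.
Proof.
rewrite /fail mulr_suml [RHS]big_mkcond /=; apply: eq_bigr => q _.
by case: answer; rewrite ?mulr0.
Qed.

(* The second half need not find anything once the answer is "yes", so failure
   probabilities multiply. *)
Lemma ok_seq_fail p1 p2 s B1 B r1 r2 Q1 Q :
  ok p1 s B1 r1 Q1 -> (0 <= r2)%R ->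
  (forall s1, Q1 s1 -> ok p2 s1 B (if answer s1 then 0 else r2)%R Q) ->
  ok (Seq p1 p2) s (B1 + B) (r1 * r2)%R Q.
Proof.
move=> [f [d [E F M L]]] r20 H2.
apply: (ok_weaken (r := (fail d * r2)%R) (Q := Q) _ (leqnn _)) => //; last by rewrite ler_wpM2r.
rewrite -sum_fail; apply: (ok_bind (R := fun x => if answer x then 0%R else r2) E _ M).
by apply: List.Forall_impl F => q [? ? ?]; split=> //; apply: H2.
Qed.

Lemma ok_seq p1 p2 s B1 B r Q1 Q :
  ok p1 s B1 1%R Q1 -> (forall s1, Q1 s1 -> ok p2 s1 B r Q) ->
  ok (Seq p1 p2) s (B1 + B) r Q.
Proof.
move=> [f [d [E F M L]]] H2.
rewrite -[r]mul1r -M /mass mulr_suml; apply: (ok_bind (R := fun=> r) E _ M).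
by apply: List.Forall_impl F => q [? ? ?]; split=> //; apply: H2.
Qed.

Lemma ok_do i p s s' B r Q c :
  instr_effect i (tick (instr_cost i s) s) = dret s' ->
  clock s' = clock s + instr_cost i s -> instr_cost i s <= c ->
  ok p s' B r Q -> ok (Seq (Do i) p) s (c + B) r Q.
Proof.
move=> Ei cl ci H; apply: ok_seq (ok_det (Q := fun x => x = s') Ei cl ci _) _ => //.
by move=> ? ->.
Qed.

Lemma ok_pick v A p s B (r : G -> rat) Q :
  vset s A != set0 ->
  (forall a, a \in vset s A -> ok p (set_vtx v (Some a) (tick 1 s)) B (r a) Q) ->
  ok (Seq (Do (VtxPick v A)) p) s (1 + B)
     ((\sum_(a in vset s A) r a) / #|vset s A|%:R)%R Q.
Proof.
move=> nz H; set X := vset s A; pose m := size (enum X).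
pose st a := set_vtx v (Some a) (tick 1 s).
pose d := [seq ((m%:R^-1 : rat)%R, st a) | a <- enum X].
have m0 : (m%:R != 0 :> rat)%R.
  by rewrite pnatr_eq0 /m -cardE -lt0n card_gt0.
have E f' : 1 <= f' -> exec f' (Do (VtxPick v A)) s = some_dist d.
  case: f' => // f' _; rewrite exec_doE /=; congr some_dist.
  by rewrite (negPf nz) /dunif /d /m size_map -map_comp.
pose R s' := if vtx s' v is Some a then r a else 0%R.
suff: ok (Seq (Do (VtxPick v A)) p) s (1 + B) (\sum_(q <- d) q.1 * R q.2)%R Q.
  move/ok_weaken; apply=> //; rewrite /d /R big_map /= eqxx.
  by rewrite -mulr_sumr mulrC big_enum /= cardE.
apply: (ok_bind E).
  rewrite /d; have: all (mem X) (enum X) by apply/allP => a; rewrite mem_enum.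
  elim: (enum X) => [_|a e IH /= /andP[aX ae]]; first exact: List.Forall_nil.
  constructor; last exact: IH.
  by split; rewrite /= ?invr_ge0 ?ler0n // /R /= eqxx; apply: H.
by rewrite /mass /d big_map big_const_seq count_predT -/m iter_addr_0 -[RHS](mulfV m0) mulr_natl.
Qed.

Lemma exec_ext p1 p2 s1 s2 B B' r Q c :
  (forall f, exec f.+1 p1 s1 = exec f p2 s2) -> clock s2 = clock s1 + c ->
  c + B <= B' -> ok p2 s2 B r Q -> ok p1 s1 B' r Q.
Proof.
move=> E cl cB [f [d [E2 F M L]]]; exists f.+1, d; split=> //.
  by case=> // f' le; rewrite E; apply: E2.
by apply: List.Forall_impl F => q [? ? ?]; split=> //; lia.
Qed.

Lemma ok_if b p1 p2 s B r Q c :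
  test_cost b s <= c ->
  ok (if test_value b s then p1 else p2) (tick (test_cost b s) s) B r Q ->
  ok (If b p1 p2) s (c + B) r Q.
Proof. by move=> le; apply: exec_ext => //=; lia. Qed.

Lemma ok_while b p s B r Q c :
  test_cost b s <= c ->
  ok (if test_value b s then Seq p (While b p) else Skip)
     (tick (test_cost b s) s) B r Q ->
  ok (While b p) s (c + B) r Q.
Proof. by move=> le; apply: exec_ext => //=; lia. Qed.

End ProgramLogic.

Section Bits.

Local Open Scope nat_scope.

Lemma leq_bits a b : a <= b -> bits a <= bits b.
Proof. by rewrite ltnS; apply: leq_trunc_log. Qed.

Lemma bits_gt0 a : 0 < bits a. Proof. by []. Qed.

Lemma bits_ltn a : a < 2 ^ bits a.
Proof. exact: trunc_log_ltn. Qed.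

Lemma bits_leq a b : a < 2 ^ b -> 0 < b -> bits a <= b.
Proof.
move=> lt b0; rewrite /bits; case: (posnP a) => [->|a0]; first by rewrite trunc_log0.
rewrite -(@ltn_exp2l 2) //; apply: leq_ltn_trans lt; exact: trunc_logP.
Qed.

Lemma bits_mul a b : bits (a * b) <= bits a + bits b.
Proof. by apply: bits_leq => //; rewrite expnD; apply: ltn_mul; apply: bits_ltn. Qed.

Lemma bits_exp a e : bits (a ^ e) <= (e * bits a).+1.
Proof.
elim: e => [|e IH]; first by rewrite expn0.
by rewrite expnS; have := bits_mul a (a ^ e); lia.
Qed.

Lemma bits_leq_self a : bits a <= a.+1.
Proof. by apply: bits_leq => //; apply: ltn_trans (ltn_expl a (isT : 1 < 2)) _; rewrite ltn_exp2l. Qed.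

End Bits.

Section Loops.

Variable G : sgraph.
Local Open Scope nat_scope.
Implicit Types (s : store G) (p : program).

Notation n := #|G|.
Notation lgn := (bits #|G|).

(* Number register 3 holds the constant 1. *)
Definition Repeat x body :=
  While (NumLe 3 x) (Seq (Do (NumOp Defs.Sub x x 3)) body).

Lemma ok_repeat x body (J : nat -> store G -> Prop) B K (rho : rat) s :
  x != 3 -> x != 1 -> (0 <= rho)%R ->
  (forall j k s', J j s' -> J j (tick k s')) ->
  (forall j s', J j s' -> num s' 3 = 1) ->
  (forall j s', J j.+1 s' -> num s' x = j.+1 ->
     ok body (set_num x j s') B rho
        (fun s'' => [/\ J j s'', num s'' x = j & answer s' -> answer s''])) ->
  J (num s x) s -> bits (num s x) <= K ->
  ok (Repeat x body) s (num s x * (B + 2 * K) + K)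
     (if answer s then 0 else rho ^+ num s x)%R (J 0).
Proof.
move=> x3 x1 rho0 Jt J3 Jbody.
suff H j s0 : num s0 x = j -> J j s0 -> bits j <= K ->
    ok (Repeat x body) s0 (j * (B + 2 * K) + K) (rho ^+ j)%R
       (fun s' => J 0 s' /\ (answer s0 -> answer s')).
  move=> Js bK; have Hs := H _ s erefl Js bK.
  case: ifP => an; last by apply: ok_weaken Hs _ _ _ => // s' [].
  by apply: ok_weaken (ok_sure Hs _) _ _ _ => // s' [] // _ /(_ an).
elim: j s0 => [|j IH] s0 xj J0 bK.
  rewrite /Repeat mul0n add0n -(addn0 K); apply: ok_while => /=.
    by rewrite (J3 _ _ J0) xj mul1n.
  rewrite (J3 _ _ J0) xj /= expr0; apply: ok_skip; split; [exact: Jt|by []].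
have bj : bits j <= K by apply: leq_trans bK; apply: leq_bits.
have -> : j.+1 * (B + 2 * K) + K = K + (K + B + (j * (B + 2 * K) + K)) by lia.
apply: ok_while => /=; first by rewrite (J3 _ _ J0) xj mul1n.
rewrite (J3 _ _ J0) xj /= exprS.
have J1 := Jt _ (bits 1 * bits j.+1) _ J0.
set s1 := tick _ _ in J1 *.
apply: (@ok_seq_fail _ _ _ _ _ _ _ _ (fun s'' => [/\ J j s'', num s'' x = j & answer s0 -> answer s''])).
- apply: (ok_do (s' := set_num x j (tick (bits j.+1) s1))) => //=.
  + by rewrite (J3 _ _ J0) xj muln1 subn1.
  + by rewrite (J3 _ _ J0) xj muln1.
  + by rewrite (J3 _ _ J0) xj muln1.
  + apply: ok_weaken (Jbody _ _ (Jt _ (bits j.+1) _ J1) _) _ _ _ => //=.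
- exact: exprn_ge0.
- move=> s2 [J2 x2 an2]; have H2 := IH s2 x2 J2 bj.
  case: ifP => an.
    apply: ok_weaken (ok_sure H2 _) _ _ _ => //; first by move=> s' [_ /(_ an)].
    by move=> s' [? /(_ an)].
  by apply: ok_weaken H2 _ _ _ => // s' [J' H']; split=> // /an2; rewrite an.
Qed.

Definition Each m body :=
  Seq (Do (NumCard m m))
      (Repeat m (Seq (Do (VtxPick m m)) (Seq (Do (SetDel m m)) body))).

Lemma ok_each m body (I : {set G} -> store G -> Prop) B s :
  3 < m ->
  (forall X k s', I X s' -> I X (tick k s')) ->
  (forall X k s', I X s' -> I X (set_num m k s')) ->
  (forall X s', I X s' -> num s' 3 = 1) ->
  (forall X a s', I X s' -> vset s' m = X -> a \in X ->
     ok body (set_vset m (X :\ a) (set_vtx m (Some a) s')) B 1%R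
        (fun s'' => [/\ I (X :\ a) s'', vset s'' m = X :\ a, num s'' m = num s' m & answer s' -> answer s''])) ->
  I (vset s m) s ->
  ok (Each m body) s (#|vset s m| * (B + 4 * lgn) + 2 * lgn) 1%R (I set0).
Proof.
move=> m3 It In I3 Ibody I0.
have bn (X : {set G}) : bits #|X| <= lgn by apply/leq_bits/max_card.
pose J j s' := exists X, [/\ I X s', vset s' m = X & #|X| = j].
pose s1 := set_num m #|vset s m| (tick (bits #|vset s m|) s).
have x1 : num s1 m = #|vset s m| by rewrite /= eqxx.
have Jt j k s' : J j s' -> J j (tick k s') by case=> X [? ? ?]; exists X; split=> //; apply: It.
have J3 j s' : J j s' -> num s' 3 = 1 by case=> X [/I3].
have J1 : J (num s1 m) s1.
  by exists (vset s m); split; rewrite ?x1 //; apply/In/It.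
apply: (@ok_weaken _ _ _ (lgn + (num s1 m * ((2 + B) + 2 * lgn) + lgn)) _
  (if answer s1 then 0 else 1 ^+ num s1 m)%R _ (J 0)).
- apply: (ok_do (s' := s1)) => //=.
  apply: (ok_repeat (x := m) (J := J)) => //; try lia; last by rewrite x1.
  move=> j s' [X [IX eX cX]] xj.
  have X0 : X != set0 by rewrite -card_gt0 cX.
  set s2 := set_num m j s'.
  apply: (@ok_le _ _ _ (1 + (1 + B)) _ ((\sum_(a in vset s2 m) 1) / #|vset s2 m|%:R)%R) => //.
  + apply: ok_pick => [|a]; rewrite /= eX // => aX.
    apply: (ok_do (s' := set_vset m (X :\ a) (tick 1 (set_vtx m (Some a) (tick 1 s2))))) => //=.
      by rewrite eqxx eX.
    have := Ibody X a (tick 1 (tick 1 s2)) _ _ aX.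
    move/(_ (It _ _ _ (It _ _ _ (In _ _ _ IX))))/(_ eX)/ok_weaken; apply=> // s'' [I'' e'' n'' an].
    split.
    - by exists (X :\ a); split=> //; move: cX; rewrite (cardsD1 a) aX => -[].
    - by rewrite n'' /= eqxx.
    - move=> as'; apply: an; rewrite /answer /= (_ : 1 == m = false) //; lia.
  + by rewrite sumr_const divff ?lexx //= eX cX pnatr_eq0.
- by rewrite x1; have := bits_gt0 n; set a := #|_|; set l := lgn => l0; nia.
- by case: ifP; rewrite ?expr1n.
- by move=> s' [X [IX _ /eqP]]; rewrite cards_eq0 => /eqP <-.
Qed.

End Loops.

(** * Exhaustive search *)

Section Blocks.

Variable G : sgraph.
Local Open Scope nat_scope.
Implicit Types (s : store G) (p : program) (S : 'I_3 -> {set G}).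

Notation n := #|G|.
Notation lgn := (bits #|G|).

(* Number register 1, the answer, is exempt. The last clause is the soundness of
   the algorithm. *)
Definition frame m s s' : Prop :=
  [/\ forall x, x < m -> x != 1 -> num s' x = num s x,
      forall x, x < m -> vtx s' x = vtx s x,
      forall x, x < m -> vset s' x = vset s x,
      answer s -> answer s'
    & answer s' -> answer s \/ has_triangle G].

Lemma num_set_num x a s : num (set_num x a s) x = a.
Proof. by rewrite /= eqxx. Qed.

Lemma vtx_set_vtx x a s : vtx (set_vtx x a s) x = a.
Proof. by rewrite /= eqxx. Qed.

Lemma vset_set_vset x X s : vset (set_vset x X s) x = X.
Proof. by rewrite /= eqxx. Qed.

Lemma frame_refl m s : frame m s s.
Proof. by split=> //; left. Qed.

Lemma frame_trans m s1 s2 s3 : frame m s1 s2 -> frame m s2 s3 -> frame m s1 s3.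
Proof.
move=> [n1 v1 S1 a1 b1] [n2 v2 S2 a2 b2]; split.
- by move=> x xm x1; rewrite n2 ?n1.
- by move=> x xm; rewrite v2 ?v1.
- by move=> x xm; rewrite S2 ?S1.
- by move/a1/a2.
- by move/b2=> [/b1|]; [|right].
Qed.

Lemma frame_le m m' s s' : frame m s s' -> m' <= m -> frame m' s s'.
Proof. by move=> [fn fv fS a b] le; split=> // x xm; [move=> ?; apply: fn|apply: fv|apply: fS]; lia. Qed.

Lemma frame_set_num m x k s s' :
  frame m s s' -> m <= x -> 1 < x -> frame m s (set_num x k s').
Proof.
move=> [fn fv fS a b] le x1; have nx : (1 == x) = false by lia.
split=> //; rewrite /answer /= ?nx //.
by move=> y ym y1; rewrite (_ : y == x = false) ?fn //; lia.
Qed.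

Lemma frame_set_vtx m x v s s' :
  frame m s s' -> m <= x -> frame m s (set_vtx x v s').
Proof.
move=> [fn fv fS a b] le; split=> //=.
by move=> y ym; rewrite (_ : y == x = false) ?fv //; lia.
Qed.

Lemma frame_set_vset m x X s s' :
  frame m s s' -> m <= x -> frame m s (set_vset x X s').
Proof.
move=> [fn fv fS a b] le; split=> //=.
by move=> y ym; rewrite (_ : y == x = false) ?fS //; lia.
Qed.

Lemma frame_num m s s' x : frame m s s' -> x < m -> x != 1 -> num s' x = num s x.
Proof. by case=> + _ _ _ _; apply. Qed.

Lemma frame_vtx m s s' x : frame m s s' -> x < m -> vtx s' x = vtx s x.
Proof. by case=> _ + _ _ _; apply. Qed.

Lemma frame_vset m s s' x : frame m s s' -> x < m -> vset s' x = vset s x.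
Proof. by case=> _ _ + _ _; apply. Qed.

Lemma frame_answer m s s' : frame m s s' -> answer s -> answer s'.
Proof. by case. Qed.

Hypothesis n_gt0 : 0 < n.

Definition adjo (o : option G) (a : G) : bool := if o is Some b then adj b a else false.

(* Set register 1 is always empty. *)
Definition Filter dst src v k :=
  Seq (Do (SetCopy dst 1)) (Seq (Do (SetCopy k src))
  (Each k (If (VtxAdj v k) (Do (SetAdd dst k)) Skip))).

Lemma ok_filter dst src v k s :
  3 < dst -> dst < k -> src < dst -> v < dst -> num s 3 = 1 -> vset s 1 = set0 ->
  ok (Filter dst src v k) s (14 * n * lgn) 1%R
    (fun s' => frame dst s s' /\
       vset s' dst = [set a in vset s src | adjo (vtx s v) a]).
Proof.
move=> d3 dk sd vd s3 S1.
have le X : #|vset s X| <= n by apply: max_card.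
pose s1 := set_vset dst (vset s 1) (tick (#|vset s dst| + #|vset s 1|).+1 s).
pose s2 := set_vset k (vset s src) (tick (#|vset s1 k| + #|vset s1 src|).+1 s1).
have es1 : vset s1 src = vset s src by rewrite /= ltn_eqF.
have es2 : vset s2 k = vset s src by rewrite /= eqxx.
apply: (@ok_le _ _ _ (n.+1 + (n + n).+1 + (n * (2 + 4 * lgn) + 2 * lgn)) _ 1%R) => //; last first.
  have := bits_gt0 n; move: n_gt0; move: n lgn => m l; nia.
rewrite -addnA; apply: (ok_do (s' := s1)) => //.
  by rewrite /instr_cost S1 cards0 addn0 ltnS.
apply: (ok_do (s' := s2)) => //.
- by rewrite /s2 -{1}es1.
- by rewrite ltnS leq_add //; apply: max_card.
apply: (@ok_le _ _ _ (#|vset s2 k| * (2 + 4 * lgn) + 2 * lgn) _ 1%R) => //; last first.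
  by rewrite es2 leq_add2r leq_mul2r le orbT.
pose I (X : {set G}) s' := [/\ frame dst s s', X \subset vset s src &
  vset s' dst = [set a in vset s src | adjo (vtx s v) a & a \notin X]].
apply: (ok_post (Q := I set0)); last first.
  by move=> s' [F _ ->]; split=> //; apply/setP => a; rewrite !inE andbT.
apply: ok_each => //; first by lia.
- move=> X j s' [F sX e]; split=> //.
  by apply: frame_set_num => //; lia.
- by move=> X s' [/frame_num-> //]; lia.
- move=> X a s' [F sX e] eX aX; set s3' := set_vset _ _ _.
  have es3 : vset s3' dst = vset s' dst by rewrite /= ltn_eqF.
  have F3 : frame dst s s3'.
    by apply: frame_set_vset; [apply: frame_set_vtx => //|]; lia.
  have v3 : vtx s3' v = vtx s v by rewrite (frame_vtx F3).
  have k3 : vtx s3' k = Some a by rewrite /= eqxx.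
  have -> : 2 = 1 + 1 by [].
  apply: ok_if => //.
  have tv : test_value (VtxAdj v k) s3' = adjo (vtx s v) a by rewrite /test_value v3 k3.
  have sX' : X :\ a \subset vset s src by apply: subset_trans sX; apply: subD1set.
  rewrite tv; case: ifP => av.
    apply: (ok_det (s' := set_vset dst (a |: vset s3' dst) (tick 1 (tick 1 s3')))) => //.
      by rewrite /= eqxx.
    split=> //.
    + split=> //; first exact: frame_set_vset.
      rewrite vset_set_vset es3 e; apply/setP => x; rewrite !inE.
      case: (eqVneq x a) => //= ->.
      by rewrite av (subsetP sX).
    + by rewrite /= eqxx gtn_eqF.
  apply: (ok_le (B := 0) (r := 1%R)) => //; apply: ok_skip; split=> //; last by rewrite /= eqxx.
  split=> //; rewrite [LHS]es3 e; apply/setP => x; rewrite !inE.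
  by case: (eqVneq x a) => //= ->; rewrite av andbF.
- have F1 : frame dst s s1 by apply: frame_set_vset => //; apply: frame_refl.
  split; first by apply: frame_set_vset; [exact: F1|exact: ltnW].
    by rewrite es2.
  rewrite es2 /= ltn_eqF // eqxx S1; apply/setP => a; rewrite !inE.
  by case: (a \in _); rewrite ?andbF.
Qed.

Definition Check k src u w :=
  Seq (Do (SetCopy k src))
  (Each k (If (VtxAdj u k) (If (VtxAdj w k) (Do (NumConst 1 1)) Skip) Skip)).

Lemma ok_check k src u w s a b :
  3 < k -> src < k -> u < k -> w < k -> num s 3 = 1 ->
  vtx s u = Some a -> vtx s w = Some b -> adj a b ->
  ok (Check k src u w) s (12 * n * lgn) 1%R
    (fun s' => frame k s s' /\
       forall c, c \in vset s src -> adj a c -> adj b c -> answer s').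
Proof.
move=> k3 sk uk wk s3 sa sb ab.
pose s1 := set_vset k (vset s src) (tick (#|vset s k| + #|vset s src|).+1 s).
have F1 : frame k s s1 by apply: frame_set_vset => //; apply: frame_refl.
have e1 : vset s1 k = vset s src by exact: vset_set_vset.
have le X : #|vset s X| <= n by apply: max_card.
apply: (@ok_le _ _ _ ((n + n).+1 + (n * (3 + 4 * lgn) + 2 * lgn)) _ 1%R) => //; last first.
  have := bits_gt0 n; move: n_gt0; move: n lgn => m l; nia.
apply: (ok_do (s' := s1)) => //; first by rewrite ltnS leq_add.
apply: (@ok_le _ _ _ (#|vset s1 k| * (3 + 4 * lgn) + 2 * lgn) _ 1%R) => //; last first.
  by rewrite e1 leq_add2r leq_mul2r le orbT.
pose I (X : {set G}) s' := frame k s s' /\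
  forall c, c \in vset s src -> c \notin X -> adj a c -> adj b c -> answer s'.
apply: (ok_post (Q := I set0)); last first.
  by move=> s' [F H]; split=> // c cs; apply: H; rewrite // inE.
apply: ok_each => //.
- move=> X j s' [F H]; split=> //; first by apply: frame_set_num => //; lia.
  by move=> c cs cX ac bc; move: (H c cs cX ac bc); rewrite /answer /= (_ : 1 == k = false) //; lia.
- by move=> X s' [/frame_num-> //]; lia.
- move=> X c s' [F H] eX cX; set s2 := set_vset _ _ _.
  have F2 : frame k s s2 by apply: frame_set_vset; [apply: frame_set_vtx|].
  have tk d : vtx (tick d s2) k = Some c by exact: vtx_set_vtx.
  have H2 c' : c' \in vset s src -> c' \notin X :\ c -> c' != c ->
      adj a c' -> adj b c' -> answer s'.
    by move=> cs + cc; rewrite !inE cc /=; apply: H.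
  have -> : 3 = 1 + (1 + 1) by [].
  apply: ok_if => //.
  have -> : test_value (VtxAdj u k) s2 = adj a c.
    by rewrite /test_value (tk 0) (frame_vtx F2) // sa.
  case: ifP => ac; last first.
    apply: (ok_le (B := 0) (r := 1%R)) => //; apply: ok_skip; split=> //; last by rewrite /= eqxx.
    split=> // c' cs cX'; case: (eqVneq c' c) => [->|]; first by rewrite ac.
    exact: H2.
  apply: ok_if => //.
  have -> : test_value (VtxAdj w k) (tick (test_cost (VtxAdj u k) s2) s2) = adj b c.
    by rewrite /test_value tk [vtx _ w](frame_vtx F2) // sb.
  case: ifP => bc; last first.
    apply: (ok_le (B := 0) (r := 1%R)) => //; apply: ok_skip; split=> //; last by rewrite /= eqxx.
    split=> // c' cs cX'; case: (eqVneq c' c) => [->|]; first by rewrite bc.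
    exact: H2.
  apply: (ok_det (s' := set_num 1 1 (tick 1 (tick 1 (tick 1 s2))))) => //.
  split=> //; last 1 first.
  + by rewrite /= gtn_eqF //; lia.
  + split=> //; case: F2 => fn fv fS fa fb; split=> //.
      by move=> x xk x1; rewrite /= (negPf x1); apply: fn.
    move=> _; right; apply/existsP; exists a; apply/existsP; exists b.
    by apply/existsP; exists c; rewrite ab bc ac.
  + exact: vset_set_vset.
- by split=> // c cs; rewrite e1 cs.
Qed.

End Blocks.

Section Light.

Variable G : sgraph.
Local Open Scope nat_scope.
Implicit Types (s : store G) (p : program).

Notation n := #|G|.
Notation lgn := (bits #|G|).

Hypothesis n_gt0 : 0 < n.

Definition nbrs (A : {set G}) (b : G) : {set G} := [set a in A | adj b a].

Definition light (q : nat) (A : {set G}) (b : G) : bool := #|nbrs A b| * q <= 5 * n.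

(* Number register 5 holds [5 * n]; [A], [B] and [C] are set registers. *)
Definition Light m A B C :=
  Seq (Do (SetCopy (m + 3) B)) (Each (m + 3)
  (Seq (Filter (m + 4) A (m + 3) (m + 5))
  (Seq (Do (NumCard (m + 5) (m + 4)))
  (Seq (Do (NumOp Defs.Mul (m + 5) (m + 5) m))
  (If (NumLe (m + 5) 5) (Each (m + 4) (Check (m + 5) C (m + 4) (m + 3))) Skip))))).

Definition light_cost q := 35 * n ^ 2 * lgn ^ 2 + 16 * (5 * n %/ q) * n ^ 2 * lgn.

Lemma bits_n5 : bits (5 * n) <= 4 * lgn.
Proof. by have := bits_mul 5 n; have := bits_gt0 n; rewrite [bits 5](erefl : _ = 3); lia. Qed.

Lemma ok_light_nbrs m C s b :
  3 < m -> C < m + 4 -> num s 3 = 1 ->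
  vtx s (m + 3) = Some b -> (forall a, a \in vset s (m + 4) -> adj b a) ->
  ok (Each (m + 4) (Check (m + 5) C (m + 4) (m + 3))) s
    (#|vset s (m + 4)| * (12 * n * lgn + 4 * lgn) + 2 * lgn) 1%R
    (fun s' => frame (m + 4) s s' /\
       forall a c, a \in vset s (m + 4) -> c \in vset s C -> adj a c -> adj b c -> answer s').
Proof.
move=> m3 Cm s3 sb Nb; set N := vset s (m + 4) in Nb *.
pose I (X : {set G}) s' := [/\ frame (m + 4) s s', X \subset N &
  forall a c, a \in N -> a \notin X -> c \in vset s C -> adj a c -> adj b c -> answer s'].
apply: (ok_post (Q := I set0)); last first.
  by move=> s' [F _ H]; split=> // a c aN; apply: H; rewrite // inE.
apply: ok_each => //; first by lia.
- move=> X k s' [F sX H]; split=> //; first by apply: frame_set_num => //; lia.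
  move=> a c aN aX cC ac bc; move: (H a c aN aX cC ac bc).
  by rewrite /answer /= (_ : 1 == m + 4 = false) //; lia.
- by move=> X s' [/frame_num-> //]; lia.
- move=> X a s' [F sX H] eX aX; set s2 := set_vset _ _ _.
  have F2 : frame (m + 4) s s2 by apply: frame_set_vset; [apply: frame_set_vtx|].
  apply: (ok_post (ok_check (a := a) (b := b) n_gt0 _ _ _ _ _ _ _ _)).
  + lia.
  + lia.
  + lia.
  + lia.
  + by rewrite (frame_num F2) //; lia.
  + by rewrite /s2 /= eqxx.
  + by rewrite (frame_vtx F2) //; lia.
  + by rewrite adj_sym; apply/Nb/(subsetP sX).
  + move=> s3' [F3 H3].
    have F4 : frame (m + 4) s s3' by apply: frame_trans F2 (frame_le F3 _); lia.
    have an3 : answer s' -> answer s3' by exact: (frame_answer F3).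
    have sk : vset s3' (m + 4) = X :\ a.
      by rewrite (frame_vset F3) ?vset_set_vset //; lia.
    split=> //; last by rewrite (frame_num F3) //; lia.
    split=> //; first by apply: subset_trans sX; apply: subD1set.
    move=> a' c aN aX' cC ac bc; case: (eqVneq a' a) => [ea|na].
      by apply: (H3 c); rewrite -?ea // (frame_vset F2) //; lia.
    by apply/an3/(H a' c) => //; move: aX'; rewrite !inE na.
- by split=> // [|a c aN]; [apply: frame_refl | rewrite aN].
Qed.

Lemma ok_light m A B C s q :
  6 < m -> A < m + 3 -> B < m + 3 -> C < m + 3 ->
  num s 3 = 1 -> num s 5 = 5 * n -> vset s 1 = set0 -> num s m = q -> 0 < q <= n ->
  ok (Light m A B C) s (light_cost q) 1%R
    (fun s' => frame (m + 3) s s' /\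
       forall a b c, a \in vset s A -> b \in vset s B -> c \in vset s C ->
         light q (vset s A) b -> adj a b -> adj a c -> adj b c -> answer s').
Proof.
move=> m6 Am Bm Cm h3 h5 S1 sq /andP[q0 qn].
have le X : #|vset s X| <= n by apply: max_card.
pose s1 := set_vset (m + 3) (vset s B) (tick (#|vset s (m + 3)| + #|vset s B|).+1 s).
have F1 : frame (m + 3) s s1 by apply: frame_set_vset => //; apply: frame_refl.
have e1 : vset s1 (m + 3) = vset s B by exact: vset_set_vset.
pose bc := 14 * n * lgn + (lgn + (lgn ^ 2 + (8 * lgn ^ 2 +
  (5 * n %/ q * (12 * n * lgn + 4 * lgn) + 2 * lgn)))).
apply: (@ok_le _ _ _ ((n + n).+1 + (n * (bc + 4 * lgn) + 2 * lgn)) _ 1%R) => //; last first.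
  rewrite /light_cost /bc; have := bits_gt0 n; move: n_gt0; move: (5 * n %/ q) => d.
  move: n lgn => m' l m0 l0.
  have hn : m' <= m' ^ 2 by rewrite -{1}(expn1 m') leq_pexp2l.
  have hl : l <= l ^ 2 by rewrite -{1}(expn1 l) leq_pexp2l.
  have h2 := leq_mul hn hl; have h8 := leq_mul (leqnn (m' ^ 2)) hl.
  have h4 := leq_mul hn (leqnn (l ^ 2)).
  have h5' : l <= m' * l by rewrite leq_pmull.
  have h6 : m' <= m' * l by rewrite leq_pmulr.
  have h7 : d * (m' * l) <= d * (m' ^ 2 * l) by rewrite !leq_mul.
  lia.
apply: (ok_do (s' := s1)) => //; first by rewrite ltnS leq_add.
apply: (@ok_le _ _ _ (#|vset s1 (m + 3)| * (bc + 4 * lgn) + 2 * lgn) _ 1%R) => //; last first.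
  by rewrite e1 leq_add2r leq_mul2r le orbT.
pose I (X : {set G}) s' := frame (m + 3) s s' /\
  forall a b c, a \in vset s A -> b \in vset s B -> b \notin X -> c \in vset s C ->
         light q (vset s A) b -> adj a b -> adj a c -> adj b c -> answer s'.
apply: (ok_post (Q := I set0)); last first.
  by move=> s' [F H]; split=> // a b c aA bB; apply: H; rewrite // inE.
apply: ok_each => //; first by lia.
- move=> X k s' [F H]; split=> //; first by apply: frame_set_num => //; lia.
  move=> a b c aA bB bX cC lb ab ac bc'; move: (H a b c aA bB bX cC lb ab ac bc').
  by rewrite /answer /= (_ : 1 == m + 3 = false) //; lia.
- by move=> X s' [/frame_num-> //]; lia.
- move=> X b s' [F H] eX bX; set s2 := set_vset _ _ _.
  have F2 : frame (m + 3) s s2 by apply: frame_set_vset; [apply: frame_set_vtx|].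
  have eX2 : vset s2 (m + 3) = X :\ b by exact: vset_set_vset.
  have b2 : vtx s2 (m + 3) = Some b by rewrite /s2 /= eqxx.
  have an2 : answer s' -> answer s2 by [].
  have n2 : num s2 (m + 3) = num s' (m + 3) by [].
  suff: ok (Seq (Filter (m + 4) A (m + 3) (m + 5))
     (Seq (Do (NumCard (m + 5) (m + 4)))
     (Seq (Do (NumOp Defs.Mul (m + 5) (m + 5) m))
     (If (NumLe (m + 5) 5) (Each (m + 4) (Check (m + 5) C (m + 4) (m + 3))) Skip)))) s2 bc 1%R
    (fun s' => frame (m + 4) s2 s' /\
       forall a c, a \in vset s A -> c \in vset s C ->
         light q (vset s A) b -> adj a b -> adj a c -> adj b c -> answer s').
    move/ok_post; apply=> s3' [F3 H3].
    split.
    + split; first by apply: frame_trans F2 (frame_le F3 _); lia.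
      move=> a b' c aA bB bX' cC lb ab ac bc'; case: (eqVneq b' b) => [eb|nb].
        by apply: (H3 a c); rewrite -?eb.
      apply/(frame_answer F3)/an2/(H a b' c) => //.
      by move: bX'; rewrite !inE nb.
    + by rewrite (frame_vset F3) //; lia.
    + by rewrite (frame_num F3) //; lia.
    + by move=> an; apply/(frame_answer F3)/an2.
  move: s2 F2 b2 {eX2 an2 n2 H eX F} => s2 F2 b2 {s' X bX}.
  have A2 : vset s2 A = vset s A by rewrite (frame_vset F2).
  apply: ok_seq.
    apply: (ok_filter n_gt0); try lia.
    + by rewrite (frame_num F2) //; lia.
    + by rewrite (frame_vset F2) //; lia.
  rewrite A2 b2 => s3' [F3 N3].
  have F03 : frame (m + 3) s s3' by apply: frame_trans F2 (frame_le F3 _); lia.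
  have {}N3 : vset s3' (m + 4) = nbrs (vset s A) b by [].
  set N := nbrs _ _ in N3.
  have cN : bits #|N| <= lgn by apply/leq_bits/max_card.
  pose s4 := set_num (m + 5) #|N| (tick (bits #|N|) s3').
  apply: (ok_do (s' := s4)); rewrite /= ?N3 //.
  have F4 : frame (m + 4) s2 s4 by apply: frame_set_num => //; lia.
  have F04 : frame (m + 3) s s4 by apply: frame_set_num => //; lia.
  have e4 : num s4 (m + 5) = #|N| by exact: num_set_num.
  have q4 : num s4 m = q by rewrite (frame_num F04) //; lia.
  have cost4 : instr_cost (NumOp Defs.Mul (m + 5) (m + 5) m) s4 = bits #|N| * bits q.
    by rewrite /instr_cost e4 q4.
  pose s5 := set_num (m + 5) (#|N| * q) (tick (bits #|N| * bits q) s4).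
  apply: (ok_do (s' := s5)).
  + by rewrite cost4 /instr_effect [num _ (m + 5)]e4 [num _ m]q4.
  + by rewrite cost4.
  + by rewrite cost4 expnS expn1 leq_mul // leq_bits.
  have F5 : frame (m + 4) s2 s5 by apply: frame_set_num => //; lia.
  have F05 : frame (m + 3) s s5 by apply: frame_set_num => //; lia.
  have e5 : num s5 (m + 5) = #|N| * q by exact: num_set_num.
  have f5 : num s5 5 = 5 * n by rewrite (frame_num F05) //; lia.
  have N5 : vset s5 (m + 4) = N by [].
  apply: ok_if.
    rewrite /test_cost e5 f5 (_ : 8 * lgn ^ 2 = (2 * lgn) * (4 * lgn)); last by lia.
    apply: leq_mul bits_n5.
    by have := bits_mul #|N| q; have := leq_bits qn; lia.
  rewrite /test_value e5 f5; case: ifP => lb; last first.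
    apply: (ok_le (B := 0) (r := 1%R)) => //; apply: ok_skip; split=> // a c _ _.
    by rewrite /light lb.
  set s6 := tick _ s5.
  apply: (@ok_weaken _ _ _ (#|vset s6 (m + 4)| * (12 * n * lgn + 4 * lgn) + 2 * lgn) _ 1%R).
  + apply: (@ok_light_nbrs m C s6 b); try lia.
    * by rewrite [num _ _](frame_num F05) //; lia.
    * by rewrite [vtx _ _](frame_vtx F5) //; lia.
    * by move=> a; rewrite [vset _ _]N5 inE => /andP[].
  + by rewrite [vset _ _]N5 leq_add2r leq_mul2r leq_divRL // lb orbT.
  + by [].
  + move=> s7 [F7 H7]; split; first exact: frame_trans F5 F7.
    move=> a c aA cC _ ab ac bc'; apply: (H7 a c) => //.
      by rewrite [vset _ _]N5 inE aA adj_sym.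
    by rewrite [vset _ _](frame_vset F05).
- by split=> // a b c aA bB; rewrite e1 bB.
Qed.

End Light.

(** * Counting copies *)

Section Counting.

Variable G : sgraph.
Local Open Scope nat_scope.
Implicit Types (S : 'I_3 -> {set G}) (tau : 'I_3 -> G) (l : seq ('I_3 * 'I_3)).

Notation n := #|G|.

Definition shrink (beta : 'I_3) (v : G) S (c : 'I_3) : {set G} :=
  if c == beta then nbrs (S c) v else S c :\ v.

Definition triangle tau : Prop := forall c d, c != d -> adj (tau c) (tau d).

Definition steps (alpha beta : 'I_3) tau S : {set G} :=
  nbrs (S alpha) (tau beta) :\: [set tau c | c in 'I_3].

(* The number of ways to choose a vertex at each step so that the triangle
   [tau] survives all the steps. *)
Fixpoint runs tau l S : nat :=
  if l is (alpha, beta) :: l' then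
    \sum_(v in steps alpha beta tau S) runs tau l' (shrink beta v S)
  else 1.

Lemma shrink_tau tau S alpha beta v :
  (forall c, tau c \in S c) -> v \in steps alpha beta tau S ->
  forall c, tau c \in shrink beta v S c.
Proof.
move=> tS; rewrite !inE => /and3P[vt _ av] c; rewrite /shrink; case: eqP => [->|_].
  by rewrite inE tS adj_sym.
rewrite !inE tS andbT; apply: contra vt => /eqP <-; exact: imset_f.
Qed.

Lemma shrink_sub beta v S c : shrink beta v S c \subset S c.
Proof.
rewrite /shrink; case: ifP => _; last exact: subD1set.
by apply/subsetP => a; rewrite inE => /andP[].
Qed.

Lemma shrink_notin beta v S c : v \notin shrink beta v S c.
Proof. by rewrite /shrink; case: ifP => _; rewrite !inE ?adj_irr ?andbF ?eqxx. Qed.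

(* Fewer than [n / q] of the at least [5 n / q - 3] steps are bad, as each bad one
   accounts for many runs. *)
Lemma many_good_steps tau S alpha beta l q :
  0 < q <= n -> ~~ light q (S alpha) (tau beta) ->
  runs tau ((alpha, beta) :: l) S * q ^ (2 ^ (size l).+1 - 1) < n ^ (size l).+1 ->
  n <= #|[set v in steps alpha beta tau S |
            runs tau l (shrink beta v S) * (q * q) ^ (2 ^ size l - 1) < n ^ size l]| * q.
Proof.
move=> /andP[q0 qn]; rewrite /light -ltnNge => heavy few.
set Gam := steps _ _ _ _; set good := [set v in Gam | _].
set e := 2 ^ size l - 1.
have e2 : q ^ (2 ^ (size l).+1 - 1) = q * (q * q) ^ e.
  rewrite mulnn -expnM -expnS; congr (_ ^ _); rewrite /e expnS.
  have := expn_gt0 2 (size l); lia.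
have many : #|nbrs (S alpha) (tau beta)| <= #|Gam| + 3.
  rewrite -(cardsID [set tau c | c in 'I_3]) addnC leq_add2l.
  apply: leq_trans (subset_leq_card (subsetIr _ _)) _.
  by apply: leq_trans (leq_imset_card _ _) _; rewrite card_ord.
have bad : #|Gam :\: good| * q < n.
  rewrite -(@ltn_pmul2r (n ^ size l)) ?expn_gt0; last by rewrite (leq_trans q0 qn).
  rewrite -expnS; apply: leq_ltn_trans few.
  rewrite e2 mulnAC mulnCA [_ * n ^ _ * q]mulnC leq_pmul2l // -sum_nat_const /= big_distrl /=.
  rewrite [X in _ <= X](big_setID good) /= (leq_trans _ (leq_addl _ _)) //.
  rewrite leq_sum // => v; rewrite !inE => /andP[+ vG].
  by rewrite vG /= -leqNgt.
have := cardsID good Gam; rewrite (setIidPr _); last by apply/subsetP => v; rewrite inE => /andP[].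
set x := #|good| in bad *; set y := #|_ :\: _| in bad *; nia.
Qed.

End Counting.

Section Embedding.

Variables (H G : sgraph) (col : H -> 'I_3) (tau : 'I_3 -> G).
Local Open Scope nat_scope.
Implicit Types (S : 'I_3 -> {set G}) (R : {set H}) (l : seq (H * 'I_3)) (f g : {ffun H -> G}).

(* [l] lists the deleted vertices in order, each with the color of its
   remaining neighbors; [R] is the leftover. *)
Fixpoint deletion R l : Prop :=
  if l is (x, beta) :: l' then
    [/\ x \notin R, x \notin unzip1 l', col x != beta,
        forall z, (z \in unzip1 l') || (z \in R) -> adj x z -> col z = beta
      & deletion R l']
  else True.

Definition colors l : seq ('I_3 * 'I_3) := [seq (col xb.1, xb.2) | xb <- l].

Definition embeds R l S g f : bool :=
  let L := unzip1 l in
  [&& [forall y, (y \notin L) ==> (f y == g y)],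
      [forall y, (y \in L) ==> (f y \in S (col y)) && (f y \notin [set tau c | c in 'I_3])],
      [forall y, forall z, [&& y \in L, z \in L & f y == f z] ==> (y == z)]
    & [forall y, forall z, [&& y \in L, (z \in L) || (z \in R) & adj y z] ==> adj (f y) (f z)]].

Lemma embedsP R l S g f : reflect
  [/\ forall y, y \notin unzip1 l -> f y = g y,
      forall y, y \in unzip1 l -> (f y \in S (col y)) && (f y \notin [set tau c | c in 'I_3]),
      forall y z, y \in unzip1 l -> z \in unzip1 l -> f y = f z -> y = z
    & forall y z, y \in unzip1 l -> (z \in unzip1 l) || (z \in R) -> adj y z ->
        adj (f y) (f z)]
  (embeds R l S g f).
Proof.
apply: (iffP and4P) => [[h1 h2 h3 h4]|[h1 h2 h3 h4]]; split.
- by move=> y yl; apply/eqP; move/forallP/(_ y)/implyP: h1; apply.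
- by move=> y yl; move/forallP/(_ y)/implyP: h2; apply.
- move=> y z yl zl e; apply/eqP; move/forallP/(_ y)/forallP/(_ z)/implyP: h3; apply.
  by rewrite yl zl e eqxx.
- move=> y z yl zl yz; move/forallP/(_ y)/forallP/(_ z)/implyP: h4; apply.
  by rewrite yl zl.
- by apply/forallP => y; apply/implyP => /h1 ->.
- by apply/forallP => y; apply/implyP => /h2.
- by apply/forallP => y; apply/forallP => z; apply/implyP => /and3P[yl zl /eqP /h3 ->].
- by apply/forallP => y; apply/forallP => z; apply/implyP => /and3P[]; apply: h4.
Qed.

Lemma runs_le_embeds R l S g :
  deletion R l -> (forall z, z \in R -> g z = tau (col z)) ->
  runs tau (colors l) S <= #|[set f | embeds R l S g f]|.
Proof.
elim: l S g => [|[x beta] l IH] S g /=.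
  move=> _ _; rewrite card_gt0; apply/set0Pn; exists g; rewrite inE.
  by apply/embedsP; split.
move=> [xR xl cxb nb del] gR.
rewrite -sum1_card (partition_big (fun f : {ffun H -> G} => f x) predT) //=.
rewrite big_mkcond leq_sum //= => v _; case: ifP => // vG.
have [vt vS tv] : [/\ v \notin [set tau c | c in 'I_3], v \in S (col x) & adj (tau beta) v].
  by move: vG; rewrite in_setD inE => /and3P[].
pose g' := [ffun y => if y == x then v else g y].
apply: leq_trans (IH _ g' del _) _.
  by move=> z zR; rewrite ffunE; case: eqP => [e|_]; [rewrite -e zR in xR | exact: gR].
rewrite sum1dep_card subset_leq_card //; apply/subsetP => f; rewrite !inE.
move=> /embedsP[f1 f2 f3 f4].
have fx : f x = v by rewrite f1 // ffunE eqxx.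
rewrite fx eqxx andbT.
have f2' y : y \in unzip1 l -> f y \in shrink beta v S (col y) by case/f2/andP.
have xz z : (z \in unzip1 l) || (z \in R) -> adj x z -> adj v (f z).
  move=> zlR az; have cz := nb z zlR az; case: (boolP (z \in unzip1 l)) => [zl|nzl].
    by have := f2' z zl; rewrite /shrink cz eqxx inE => /andP[].
  have zR : z \in R by move: zlR; rewrite (negPf nzl).
  rewrite f1 // ffunE; case: eqP => [e|_]; first by rewrite -e zR in xR.
  by rewrite gR // cz adj_sym.
apply/embedsP; split => /=.
- move=> y; rewrite inE negb_or => /andP[yx yl].
  by rewrite f1 // ffunE (negPf yx).
- move=> y; rewrite inE => /predU1P[->|yl]; first by rewrite fx vS.
  have /andP[a ->] := f2 y yl; rewrite andbT.
  by apply: (subsetP (shrink_sub _ _ _ _)) a.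
- have key y : y \in unzip1 l -> f y != v.
    move=> yl; apply/eqP => e; have := f2' y yl.
    by rewrite e (negPf (shrink_notin _ _ _ _)).
  move=> y z; rewrite !inE => /predU1P[->|yl] /predU1P[->|zl] //.
  + by rewrite fx => /esym/eqP; rewrite (negPf (key z zl)).
  + by rewrite fx => /eqP; rewrite (negPf (key y yl)).
  + exact: f3.
- move=> y z; rewrite !inE => /predU1P[->|yl] zl.
    move=> az; rewrite fx; apply: xz => //; move: zl.
    by case: eqP az => [->|//]; rewrite adj_irr.
  case: (eqVneq z x) zl => [-> _ /= yx|_ /= zl yz]; last exact: f4.
  by rewrite fx adj_sym; apply: xz; rewrite ?yl 1?adj_sym.
Qed.

Lemma runs_le_copies R l :
  deletion R l -> [set: H] = R :|: [set x in unzip1 l] ->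
  {in R &, injective col} -> proper_coloring col -> triangle tau ->
  runs tau (colors l) (fun _ => [set: G]) <= num_copies H G.
Proof.
move=> del cover injR proper tri.
pose g := [ffun y => tau (col y)].
apply: leq_trans (runs_le_embeds _ (g := g) del _) _; first by move=> z _; rewrite ffunE.
apply/subset_leq_card/subsetP => f; rewrite !inE => /embedsP[f1 f2 f3 f4].
have cov y : y \notin unzip1 l -> y \in R.
  by move=> yl; have := in_setT y; rewrite cover !inE (negPf yl) orbF.
have key y z : y \notin unzip1 l -> z \in unzip1 l -> f y != f z.
  move=> yl zl; rewrite f1 // ffunE; apply/eqP => e; have /andP[_] := f2 z zl.
  by rewrite -e imset_f.
have tinj c d : tau c = tau d -> c = d.
  by move=> e; apply/eqP; apply/negPn/negP => /tri; rewrite e adj_irr.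
apply/andP; split.
  apply/injectiveP => y z e.
  case: (boolP (y \in unzip1 l)) => yl; case: (boolP (z \in unzip1 l)) => zl.
  - exact: f3.
  - by have := key z y zl yl; rewrite e eqxx.
  - by have := key y z yl zl; rewrite e eqxx.
  - apply: injR; rewrite ?cov //; apply: tinj.
    by move: e; rewrite !f1 // !ffunE.
apply/forallP => y; apply/forallP => z; apply/implyP => yz.
case: (boolP (y \in unzip1 l)) => yl.
  by apply: f4 => //; case: (boolP (z \in unzip1 l)) => //= /cov.
case: (boolP (z \in unzip1 l)) => zl.
  by rewrite adj_sym; apply: f4; rewrite ?cov ?orbT // adj_sym.
by rewrite !f1 // !ffunE; apply/tri/proper.
Qed.

End Embedding.

Section Deletion.

Variables (H : sgraph) (col : H -> 'I_3).
Local Open Scope nat_scope.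

Lemma other_color (c : 'I_3) : exists d : 'I_3, c != d.
Proof. by exists (if c == ord0 then ord_max else ord0); case: (eqVneq c ord0) => [->|]. Qed.

Lemma deletes_to_deletion (T R : {set H}) :
  proper_coloring col -> deletes_to col T R ->
  exists l, [/\ deletion col R l, uniq (unzip1 l), [disjoint R & unzip1 l]
    & T = R :|: [set x in unzip1 l]].
Proof.
move=> proper; elim=> [S|S R' x /andP[xS /forall_inP mono] _ [l [del un dis e]]].
  exists [::]; split=> //; last by apply/setP => x; rewrite !inE orbF.
  by rewrite disjoint_sym disjoint0.
have xl : (x \notin R') && (x \notin unzip1 l).
  by have := setD11 x S; rewrite e !inE => /negbT; rewrite negb_or.
have inS z : (z \in unzip1 l) || (z \in R') -> z \in S.
  by move=> h; have: z \in S :\ x; [rewrite e !inE orbC | rewrite inE => /andP[]].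
have [beta [xb nb]] : exists beta, col x != beta /\ forall z, z \in S -> adj x z -> col z = beta.
  case: (pickP [pred z in S | adj x z]) => [y /andP[/= yS xy]|no].
    exists (col y); split; first exact: proper.
    move=> z zS xz; apply/eqP.
    by have /forall_inP/(_ y yS)/implyP/(_ xz)/implyP/(_ xy) := mono z zS.
  have [d cd] := other_color (col x); exists d; split=> // z zS xz.
  by have := no z; rewrite /= zS xz.
exists ((x, beta) :: l); split=> /=.
- by case/andP: xl => ? ?; split=> // z /inS; apply: nb.
- by case/andP: xl => _ ->.
- rewrite disjoint_sym disjoint_cons disjoint_sym dis andbT; by case/andP: xl.
- apply/setP => z; have /setP/(_ z) := e; rewrite !inE /=.
  by case: eqP => [-> _|_ /= ->]; rewrite // xS orbT.
Qed.

End Deletion.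

(** * The recursive search *)

Section Sampling.

Local Open Scope ring_scope.

Lemma bernoulli (R : realFieldType) (x : R) m : 0 <= x -> 1 + m%:R * x <= (1 + x) ^+ m.
Proof.
move=> x0; elim: m => [|m IH]; first by rewrite mul0r addr0.
rewrite exprS; have m0 : 0 <= m%:R :> R by [].
have h : (1 + x) * (1 + m%:R * x) <= (1 + x) * (1 + x) ^+ m by rewrite ler_wpM2l //; lra.
by apply: le_trans h; rewrite -natr1; nra.
Qed.

Lemma sample_fail (q L n : nat) : (0 < q)%N -> (0 < n)%N -> (n < 2 ^ L)%N ->
  (1 - (q.*2%:R)^-1) ^+ (q * L.*2) <= n%:R^-1 :> rat.
Proof.
move=> q0 n0 nL; set m := q.*2.
have m0 : (0 : rat) < m%:R by rewrite ltr0n double_gt0.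
have x0 : (0 : rat) < m%:R^-1 by rewrite invr_gt0.
have x1 : m%:R^-1 <= 1 :> rat by rewrite invf_le1 // ler1n double_gt0.
set x : rat := m%:R^-1 in x0 x1 *.
have half : (1 - x) ^+ m <= 2^-1.
  have h2 : 2 <= (1 + x) ^+ m.
    by apply: le_trans (bernoulli m (ltW x0)); rewrite mulfV ?gt_eqF.
  have h1 : (1 - x) ^+ m * (1 + x) ^+ m <= 1.
    by rewrite -exprMn exprn_ile1 //; nra.
  have h0 : 0 <= (1 - x) ^+ m by rewrite exprn_ge0 //; lra.
  by rewrite -[2^-1]mul1r ler_pdivlMr //; nra.
rewrite (_ : q * L.*2 = m * L)%N; last by rewrite /m; lia.
rewrite exprM; apply: (@le_trans _ _ (2^-1 ^+ L)).
  by rewrite lerXn2r ?nnegrE // exprn_ge0 //; lra.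
by rewrite exprVn lef_pV2 ?posrE ?exprn_gt0 ?ltr0n // -natrX ler_nat ltnW.
Qed.

End Sampling.

Section Descend.

Variable G : sgraph.
Local Open Scope nat_scope.
Implicit Types (s : store G) (p : program) (S : 'I_3 -> {set G}).

Notation n := #|G|.
Notation lgn := (bits #|G|).

Hypothesis n_gt0 : 0 < n.

Definition CopyDel dst src v := Seq (Do (SetCopy dst src)) (Do (SetDel dst v)).

Lemma ok_copydel dst src v s :
  ok (CopyDel dst src v) s ((n + n).+1 + 1) 1%R (fun s' =>
    [/\ frame dst s s', forall x, x != dst -> vset s' x = vset s x,
        vtx s' = vtx s, num s' = num s
      & forall a, vtx s v = Some a -> vset s' dst = vset s src :\ a]).
Proof.
pose s1 := set_vset dst (vset s src) (tick (#|vset s dst| + #|vset s src|).+1 s).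
have F1 : frame dst s s1 by apply: frame_set_vset => //; apply: frame_refl.
have e1 : vset s1 dst = vset s src by exact: vset_set_vset.
have O1 x : x != dst -> vset s1 x = vset s x by move=> /negPf xd; rewrite /= xd.
apply: (ok_do (s' := s1)) => //; first by rewrite ltnS leq_add //; apply: max_card.
case E: (vtx s v) => [a|]; last first.
  by apply: (ok_det (s' := tick 1 s1)); rewrite // /= E.
apply: (ok_det (s' := set_vset dst (vset s src :\ a) (tick 1 s1))) => //.
  by rewrite /= E eqxx.
split=> //; first exact: frame_set_vset.
  by move=> x xd; rewrite -[RHS]O1 // /= (negPf xd).
by move=> _ [<-]; exact: vset_set_vset.
Qed.

Definition Descend m (alpha beta gamma : 'I_3) :=
  Seq (Filter (m + 4 + beta) (m + beta) (m + 3) (m + 7))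
  (Seq (CopyDel (m + 4 + alpha) (m + alpha) (m + 3))
  (Seq (CopyDel (m + 4 + gamma) (m + gamma) (m + 3))
       (Do (NumOp Defs.Mul (m + 4) m m)))).

Lemma ok_descend m (alpha beta gamma : 'I_3) s q :
  3 < m -> num s 3 = 1 -> vset s 1 = set0 -> num s m = q -> q <= n ->
  alpha != beta -> gamma != alpha -> gamma != beta ->
  ok (Descend m alpha beta gamma) s (24 * n * lgn ^ 2) 1%R (fun s' =>
    [/\ frame (m + 4) s s', num s' (m + 4) = q * q
      & forall v, vtx s (m + 3) = Some v ->
        forall c : 'I_3, vset s' (m + 4 + c) = shrink beta v (fun c => vset s (m + c)) c]).
Proof.
move=> m3 h3 S1 hq qn ab ga gb.
have lt3 (c : 'I_3) : c < 3 by [].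
have nab : nat_of_ord alpha != beta by [].
have nga : nat_of_ord gamma != alpha by [].
have ngb : nat_of_ord gamma != beta by [].
apply: (@ok_le _ _ _ (14 * n * lgn +
  ((n + n).+1 + 1 + ((n + n).+1 + 1 + lgn ^ 2))) _ 1%R) => //; last first.
  have := bits_gt0 n; move: n_gt0; move: n lgn => k l k0 l0.
  have h1 : l <= l ^ 2 by rewrite -{1}(expn1 l) leq_pexp2l.
  have h4 := leq_mul (leqnn k) h1.
  have h2 : l ^ 2 <= k * l ^ 2 by rewrite leq_pmull.
  have h3' : k <= k * l by rewrite leq_pmulr.
  lia.
apply: ok_seq.
  by apply: (ok_filter n_gt0) => //; have := lt3 beta; lia.
move=> s1 [F1 e1].
have {}F1 : frame (m + 4) s s1 by apply: frame_le F1 _; lia.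
apply: ok_seq (ok_copydel _ _ _ _) _ => s2 [F2 O2 v2 _ e2].
have {}F2 : frame (m + 4) s s2 by apply: frame_trans F1 (frame_le F2 _); lia.
apply: ok_seq (ok_copydel _ _ _ _) _ => s3 [F3 O3 v3 _ e3].
have {}F3 : frame (m + 4) s s3 by apply: frame_trans F2 (frame_le F3 _); lia.
have q3 : num s3 m = q by rewrite (frame_num F3) //; lia.
apply: (ok_det (s' := set_num (m + 4) (q * q) (tick (bits q * bits q) s3))).
- by rewrite /instr_effect /instr_cost q3 [num _ m]q3.
- by rewrite /instr_cost q3.
- by rewrite /instr_cost q3 expnS expn1 leq_mul // leq_bits.
split; [by apply: frame_set_num => //; lia | exact: num_set_num | ].
move=> v sv c; rewrite /shrink.
have [-> | [-> | ->]] : c = beta \/ c = alpha \/ c = gamma.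
  case: (eqVneq c beta) => [->|cb]; first by left.
  case: (eqVneq c alpha) => [->|ca]; [by right; left | right; right; apply/val_inj => /=].
  have ncb : nat_of_ord c != beta by []; have nca : nat_of_ord c != alpha by [].
  have := lt3 c; have := lt3 alpha; have := lt3 beta; have := lt3 gamma; lia.
- rewrite eqxx [LHS]O3 ?O2 ?e1 ?sv //.
  + by rewrite eqn_add2l eq_sym.
  + by rewrite eqn_add2l eq_sym.
- rewrite (negPf ab) [LHS]O3 ?(e2 v) ?(frame_vset F1) ?(frame_vtx F1) //.
  + have := lt3 alpha; lia.
  + have := lt3 alpha; lia.
  + by rewrite eqn_add2l eq_sym.
- rewrite (negPf gb) [LHS](e3 v) ?(frame_vset F2) ?(frame_vtx F2) //.
  + have := lt3 gamma; lia.
  + have := lt3 gamma; lia.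
Qed.

End Descend.

Section Level.

Variable G : sgraph.
Local Open Scope nat_scope.
Implicit Types (s : store G) (S : 'I_3 -> {set G}) (tau : 'I_3 -> G) (l : seq ('I_3 * 'I_3)).

Notation n := #|G|.
Notation lgn := (bits #|G|).

Hypothesis n_gt0 : 0 < n.

Definition third (alpha beta : 'I_3) : 'I_3 := (- (alpha + beta))%R.

Lemma thirdP alpha beta :
  alpha != beta -> third alpha beta != alpha /\ third alpha beta != beta.
Proof. by case: alpha => [[|[|[|//]]] ?]; case: beta => [[|[|[|//]]] ?]. Qed.

(* At level [m], number register [m] holds [q] and set registers [m], [m + 1] and
   [m + 2] hold the candidates for the three colors. *)
Fixpoint Level m l : program :=
  if l is (alpha, beta) :: l' then
    let gamma := third alpha beta in
    Seq (Light m (m + alpha) (m + beta) (m + gamma))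
    (Seq (Do (NumOp Defs.Mul (m + 3) m 4))
    (Repeat (m + 3)
      (Seq (Do (VtxPick (m + 3) (m + alpha)))
      (Seq (Descend m alpha beta gamma) (Level (m + 4) l')))))
  else Skip.

Fixpoint level_cost l q : nat :=
  if l is _ :: l' then
    light_cost G q + (3 * lgn ^ 2 +
     (q * lgn.*2 * (1 + (24 * n * lgn ^ 2 + level_cost l' (q * q)) + 2 * (4 * lgn)) + 4 * lgn))
  else 0.

Variable L : nat.
Hypotheses (n_lt_L : n < 2 ^ L) (L_le_lgn : L <= lgn).

Definition env s : Prop :=
  [/\ num s 3 = 1, num s 4 = L.*2, num s 5 = 5 * n & vset s 1 = set0].

Lemma frame_env m s s' : 6 < m -> frame m s s' -> env s -> env s'.
Proof.
move=> m6 F [e3 e4 e5 E]; split.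
- by rewrite (frame_num F) //; lia.
- by rewrite (frame_num F) //; lia.
- by rewrite (frame_num F) //; lia.
- by rewrite (frame_vset F) //; lia.
Qed.

Lemma eq_runs tau l S S' : S =1 S' -> runs tau l S = runs tau l S'.
Proof.
elim: l S S' => [//|[alpha beta] l IH] S S' e /=.
rewrite /steps e; apply: eq_bigr => v _; apply: IH => c.
by rewrite /shrink e.
Qed.

(* Either every vertex is light, or too few ways to keep [tau] alive remain for
   all of them to fail. *)
Definition alive l q tau S : Prop :=
  [/\ triangle tau, forall c, tau c \in S c &
      l != [::] /\ q = 1 \/ runs tau l S * q ^ (2 ^ size l - 1) < n ^ size l].

Lemma sample_mean (X Y : {set G}) q :
  0 < q -> 1 < n -> Y \subset X -> n <= #|Y| * q ->
  ((\sum_(a in X) (if a \in Y then n%:R^-1 else 1)) / #|X|%:R <= 1 - (q.*2%:R)^-1 :> rat)%R.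
Proof.
move=> q0 n1 YX cY.
have X0 : 0 < #|X|.
  by apply: leq_trans (subset_leq_card YX); rewrite lt0n; apply: contraTneq cY => ->; lia.
have nz m' : 0 < m' -> (0 < m'%:R :> rat)%R by rewrite ltr0n.
have n0 := nz _ (ltnW n1); have q0' := nz _ q0; have X0' := nz _ X0.
rewrite ler_pdivrMr // (big_setID Y) /= (setIidPr YX).
rewrite (eq_bigr (fun=> n%:R^-1)%R) => [|a ->] //.
rewrite [X in (_ + X)%R](eq_bigr (fun=> 1%R)) => [|a]; last by rewrite inE => /andP[/negPf->].
rewrite !sumr_const cardsD (setIidPr YX) natrB ?subset_leq_card // -mul2n natrM invfM -[X in (X + _)%R]mulr_natr.
have n2 : (n%:R^-1 <= 2^-1 :> rat)%R by rewrite lef_pV2 ?posrE // ler_nat.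
have Yq : (#|X|%:R * q%:R^-1 <= #|Y|%:R :> rat)%R.
  by rewrite ler_pdivrMr // -natrM ler_nat (leq_trans (max_card _)).
have Y0 : (0 <= #|Y|%:R :> rat)%R by [].
have h := ler_wpM2r Y0 n2.
lra.
Qed.

Lemma ok_level l m s q (rho : rat) :
  6 < m -> all (fun ab => ab.1 != ab.2) l -> env s -> num s m = q -> 0 < q ->
  (l != [::] -> q ^ (2 ^ (size l).-1) <= n) ->
  rho = 1%R \/ rho = (n%:R^-1)%R /\
    (exists tau, alive l q tau (fun c => vset s (m + c))) ->
  ok (Level m l) s (level_cost l q) rho (frame (m + 3) s).
Proof.
elim: l m s q rho => [|[alpha beta] l IH] m s q rho m6 neq envs sq q0 qn rhoP.
  case: rhoP => [->|[_ [tau [_ _]]]]; first by apply: ok_skip; apply: frame_refl.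
  by case=> [[]|] //.
have /andP[/= ab neql] := neq.
have [ga gb] := thirdP ab.
rewrite [Level _ _]/=; set gamma := third alpha beta in ga gb *.
have {}qn : q ^ (2 ^ size l) <= n by apply: qn.
have qn1 : q <= n.
  by apply: leq_trans qn; rewrite -{1}(expn1 q) leq_pexp2l ?expn_gt0.
have lt3 (c : 'I_3) : c < 3 by [].
have [h3 h4 h5 H1] := envs.
pose S (c : 'I_3) := vset s (m + c).
have body s' (rho1 : rat) : frame (m + 3) s s' ->
    rho1 = 1%R \/ rho1 = (1 - q.*2%:R^-1)%R /\
       (exists tau, alive ((alpha, beta) :: l) q tau S /\ ~~ light q (S alpha) (tau beta)) ->
    ok (Seq (Do (VtxPick (m + 3) (m + alpha)))
       (Seq (Descend m alpha beta gamma) (Level (m + 4) l))) s'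
     (1 + (24 * n * lgn ^ 2 + level_cost l (q * q))) rho1
     (fun s'' => frame (m + 3) s' s'' /\ num s'' (m + 3) = num s' (m + 3)).
  move=> F1 rho1P.
  have after s2 (rho2 : rat) : frame (m + 3) s s2 ->
      rho2 = 1%R \/ rho2 = (n%:R^-1)%R /\ (exists tau v,
        vtx s2 (m + 3) = Some v /\ alive l (q * q) tau (shrink beta v S)) ->
      ok (Seq (Descend m alpha beta gamma) (Level (m + 4) l)) s2
        (24 * n * lgn ^ 2 + level_cost l (q * q)) rho2 (frame (m + 4) s2).
    move=> F2 rho2P; have [e3 e4 e5 E] := frame_env (m := m + 3) ltac:(lia) F2 envs.
    have q2 : num s2 m = q by rewrite (frame_num F2) //; lia.
    apply: ok_seq.
      by apply: (ok_descend n_gt0 (q := q)) => //; lia.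
    move=> s3 [F3 q3 S3].
    apply: (ok_post (Q := frame (m + 4 + 3) s3)); last first.
      by move=> s4 F4; apply: frame_trans F3 (frame_le F4 _); lia.
    apply: IH => //.
    - lia.
    - by apply: frame_env F3 _ => //; lia.
    - by rewrite muln_gt0 q0.
    - case: (l) qn => [//|ab' l'] qn _; rewrite mulnn -expnM -expnS; exact: qn.
    - case: rho2P => [->|[-> [tau [v [v2 [tri tS few]]]]]]; [by left|right; split=> //].
      exists tau; have e (c : 'I_3) : vset s3 (m + 4 + c) = shrink beta v S c.
        rewrite (S3 v v2) /shrink; case: ifP => _; rewrite (frame_vset F2) //;
          have := lt3 c; lia.
      by split=> // [c|]; rewrite ?e // (eq_runs _ _ e).
  have Sa : vset s' (m + alpha) = S alpha.
    by rewrite (frame_vset F1) //; have := lt3 alpha; lia.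
  have F2 a : frame (m + 3) s' (set_vtx (m + 3) a (tick 1 s')).
    by apply: frame_set_vtx => //; apply: frame_refl.
  case: (eqVneq (S alpha) set0) => [S0|S0].
    case: rho1P => [->|[_ [tau [[_ tS _] _]]]]; last by have := tS alpha; rewrite S0 inE.
    apply: (ok_do (s' := tick 1 s')) => //; first by rewrite /= Sa S0 eqxx.
    apply: (ok_post (after _ _ _ _)) => //; first by left.
    by move=> s3 F3; split; [apply: frame_le F3 _; lia | rewrite (frame_num F3) //; lia].
  case: rho1P => [->|[-> [tau [[tri tS few] heavy]]]].
    apply: (@ok_le _ _ _ _ _ ((\sum_(a in vset s' (m + alpha)) 1) / #|vset s' (m + alpha)|%:R)%R).
    - apply: ok_pick => [|a aS]; first by rewrite Sa.
      apply: (ok_post (after _ _ (frame_trans F1 (F2 _)) _)); first by left.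
      move=> s3 F3; split; last by rewrite (frame_num F3) //; lia.
      by apply: frame_trans (F2 (Some a)) (frame_le F3 _); lia.
    - by [].
    - by rewrite sumr_const divff // pnatr_eq0 -lt0n card_gt0 Sa.
  case: few => [[_ q1]|few].
    move: heavy; rewrite /light q1 muln1; have := max_card (nbrs (S alpha) (tau beta)); lia.
  have n1 : 1 < n.
    have tab : tau alpha != tau beta.
      by apply/eqP => e; have := tri _ _ ab; rewrite e adj_irr.
    by have := max_card [set tau alpha; tau beta]; rewrite cards2 tab.
  pose Y := [set v in steps alpha beta tau S |
     runs tau l (shrink beta v S) * (q * q) ^ (2 ^ size l - 1) < n ^ size l].
  have cY : n <= #|Y| * q by apply: many_good_steps; rewrite ?q0.
  have YX : Y \subset vset s' (m + alpha).
    by rewrite Sa; apply/subsetP => v; rewrite !inE => /andP[/and3P[]].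
  apply: (ok_le _ (leqnn _) (sample_mean q0 n1 YX cY)).
  apply: ok_pick => [|a aS]; first by rewrite Sa.
  apply: (ok_post (after _ _ (frame_trans F1 (F2 _)) _)).
    case: ifP => [|_]; [rewrite inE => /andP[aG few'] | by left].
    right; split=> //; exists tau, a; split; first exact: vtx_set_vtx.
    by split=> //; [apply: shrink_tau aG | right].
  move=> s3 F3; split; last by rewrite (frame_num F3) //; lia.
  by apply: frame_trans (F2 (Some a)) (frame_le F3 _); lia.
have rest s' (rho1 : rat) : frame (m + 3) s s' ->
    rho1 = 1%R \/ rho1 = (n%:R^-1)%R /\
       (exists tau, alive ((alpha, beta) :: l) q tau S /\ ~~ light q (S alpha) (tau beta)) ->
    ok (Seq (Do (NumOp Defs.Mul (m + 3) m 4))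
    (Repeat (m + 3)
      (Seq (Do (VtxPick (m + 3) (m + alpha)))
      (Seq (Descend m alpha beta gamma) (Level (m + 4) l))))) s'
     (3 * lgn ^ 2 +
     (q * lgn.*2 * (1 + (24 * n * lgn ^ 2 + level_cost l (q * q)) + 2 * (4 * lgn)) + 4 * lgn))
     rho1 (frame (m + 3) s').
  move=> F1 rho1P.
  have q1 : num s' m = q by rewrite (frame_num F1) //; lia.
  have [e3 e4 e5 E] := frame_env (m := m + 3) ltac:(lia) F1 envs.
  have bq : bits q <= lgn by apply: leq_bits.
  have bL : bits L.*2 <= 3 * lgn.
    by have := bits_leq_self L.*2; have := bits_gt0 n; lia.
  pose s1 := set_num (m + 3) (q * L.*2) (tick (bits q * bits L.*2) s').
  apply: (ok_do (s' := s1)).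
  - by rewrite /instr_effect /instr_cost q1 e4 [num _ m]q1 [num _ 4]e4.
  - by rewrite /instr_cost q1 e4.
  - by rewrite /instr_cost q1 e4 mulnC (_ : 3 * lgn ^ 2 = 3 * lgn * lgn) ?leq_mul //; lia.
  pose rho2 : rat := if rho1 == 1%R then 1%R else (1 - q.*2%:R^-1)%R.
  have x1 : num s1 (m + 3) = q * L.*2 by exact: num_set_num.
  have rho20 : (0 <= rho2)%R.
    rewrite /rho2; case: eqP => // _; rewrite subr_ge0 invf_le1 ?ltr0n ?ler1n double_gt0 //.
  apply: (@ok_le _ _ _ (num s1 (m + 3) *
      (1 + (24 * n * lgn ^ 2 + level_cost l (q * q)) + 2 * (4 * lgn)) + 4 * lgn) _
      (if answer s1 then 0 else rho2 ^+ num s1 (m + 3))%R).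
  - apply: (ok_repeat (J := fun _ => frame (m + 3) s')) => //.
    + lia.
    + lia.
    + by move=> _ s2 F2; rewrite (frame_num F2) //; lia.
    + move=> j s2 F2 _.
      have F3 : frame (m + 3) s2 (set_num (m + 3) j s2).
        by apply: frame_set_num; [apply: frame_refl| |]; lia.
      apply: (ok_post (body (set_num (m + 3) j s2) rho2 (frame_trans (frame_trans F1 F2) F3) _)).
        rewrite /rho2; case: eqP => [_|ne]; [by left | right; split=> //].
        by case: rho1P => [//|[]].
      move=> s4 [F4 ->]; split; last by move/(frame_answer F3)/(frame_answer F4).
        exact: frame_trans F2 (frame_trans F3 F4).
      by rewrite num_set_num.
    + by apply: frame_set_num; [apply: frame_refl| |]; lia.
    + by rewrite x1; have := bits_mul q L.*2; lia.
  - by rewrite x1 leq_add2r !leq_mul // leq_double.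
  - have rho10 : (0 <= rho1)%R by case: rho1P => [->|[-> _]]; rewrite ?invr_ge0 ?ler0n.
    case: ifP => // _; rewrite x1 /rho2; case: eqP => [->|ne]; first by rewrite expr1n.
    by case: rho1P => [//|[-> _]]; apply: sample_fail.
rewrite [level_cost _ _]/=.
have Hlight : ok (Light m (m + alpha) (m + beta) (m + gamma)) s (light_cost G q) 1%R
    (fun s' => frame (m + 3) s s' /\
       forall a b c, a \in S alpha -> b \in S beta -> c \in S gamma ->
         light q (S alpha) b -> adj a b -> adj a c -> adj b c -> answer s').
  apply: ok_light => //; rewrite ?ltn_add2l ?q0 //.
apply: ok_seq Hlight _ => s1 [F1 found].
case: rhoP => [->|[-> [tau [tri tS few]]]].
  apply: (ok_post (rest s1 1%R F1 _)); first by left.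
  by move=> s2; apply: frame_trans.
case: (boolP (light q (S alpha) (tau beta))) => [lb|heavy].
  have an1 : answer s1.
    apply: (found (tau alpha) (tau beta) (tau gamma)) => //; apply: tri; rewrite // eq_sym //.
  apply: (ok_weaken (r := 0%R) (Q := frame (m + 3) s1) _ (leqnn _)).
  - apply: (@ok_sure _ _ _ _ 1%R); first by apply: rest => //; left.
    by move=> s2 /frame_answer; apply.
  - by rewrite invr_ge0 ler0n.
  - by move=> s2; apply: frame_trans.
apply: (ok_post (rest s1 _ F1 _)); last by move=> s2; apply: frame_trans.
by right; split=> //; exists tau.
Qed.

End Level.

Section Cost.

Variable G : sgraph.
Local Open Scope nat_scope.
Implicit Types (l : seq ('I_3 * 'I_3)).

Notation n := #|G|.
Notation lgn := (bits #|G|).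

Hypothesis n_gt0 : 0 < n.

Fixpoint level_const (k : nat) : nat := if k is k'.+1 then 188 + 2 * level_const k' else 0.

Lemma level_cost_bound l q :
  0 < q -> (l != [::] -> q ^ (2 ^ (size l).-1) <= n) ->
  level_cost G l q * q <= level_const (size l) * lgn ^ (3 * size l) * n ^ 3.
Proof.
elim: l q => [//|ab l IH] q q0 qn.
have {}qn : q ^ (2 ^ size l) <= n by apply: qn.
have qn1 : q <= n by apply: leq_trans qn; rewrite -{1}(expn1 q) leq_pexp2l ?expn_gt0.
have {}IH : level_cost G l (q * q) * (q * q) <=
    level_const (size l) * lgn ^ (3 * size l) * n ^ 3.
  apply: IH; first by rewrite muln_gt0 q0.
  by case: (l) qn => [//|ab' l'] qn _; rewrite mulnn -expnM -expnS; exact: qn.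
rewrite /= /light_cost; move: (level_cost G l (q * q)) IH => tc IH.
have div : 5 * n %/ q * q <= 5 * n by apply: leq_divM.
move: (5 * n %/ q) div => d div.
rewrite (_ : 3 * (size l).+1 = 3 * size l + 3); last by lia.
rewrite expnD.
have l0 := bits_gt0 n.
have e0 : 0 < lgn ^ (3 * size l) by rewrite expn_gt0.
move: (level_const (size l)) (lgn ^ (3 * size l)) IH e0 n_gt0 qn1 l0 div => K e IH e0.
move: IH; move: n lgn => {qn} m b IH m0 qm b0 div.
rewrite -mul2n.
have hb1 : b <= b ^ 3 by rewrite -{1}(expn1 b) leq_pexp2l.
have hb2 : b ^ 2 <= b ^ 3 by rewrite leq_pexp2l.
have hq2 : q * q <= m ^ 2 by rewrite -mulnn leq_mul.
have hm1 : q <= m ^ 3 by apply: leq_trans qm _; rewrite -{1}(expn1 m) leq_pexp2l.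
have hm2 : m ^ 2 * q <= m ^ 3 by rewrite [m ^ 3]expnSr leq_mul.
set X := b ^ 3 * m ^ 3.
have t1 : b ^ 2 * (m ^ 2 * q) <= X by apply: leq_mul.
have t2 : b * (m ^ 2 * (d * q)) <= 5 * X.
  rewrite (_ : 5 * X = b ^ 3 * (m ^ 2 * (5 * m))); last by rewrite /X; ring.
  exact: leq_mul hb1 (leq_mul (leqnn _) div).
have t3 : b ^ 2 * q <= X by apply: leq_mul.
have t4 : (q * q) * (b * (1 + 24 * m * b ^ 2 + 8 * b)) <= 33 * X.
  rewrite (_ : 33 * X = m ^ 2 * (b * (33 * m * b ^ 2))); last by rewrite /X; ring.
  apply: leq_mul => //; rewrite leq_mul2l; apply/orP; right.
  have : b <= b ^ 2 by rewrite -{1}(expn1 b) leq_pexp2l.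
  have : b ^ 2 <= m * b ^ 2 by rewrite leq_pmull.
  lia.
have t5 : b * (tc * (q * q)) <= K * e * X.
  apply: leq_trans (leq_mul hb1 IH) _; rewrite /X; apply: eq_leq; ring.
have t6 : b * q <= X by apply: leq_mul.
have t7 : X <= e * X by rewrite leq_pmull.
have -> : (188 + 2 * K) * (e * b ^ 3) * m ^ 3 = 188 * (e * X) + 2 * (K * e * X).
  by rewrite /X; ring.
move: t1 t2 t3 t4 t5 t6 t7; lia.
Qed.

End Cost.

(** * Choice of the parameters *)

Section Setup.

Variable G : sgraph.
Local Open Scope nat_scope.
Implicit Types (s : store G).

Notation n := #|G|.
Notation lgn := (bits #|G|).

Hypothesis n_gt0 : 0 < n.

Fixpoint Pow dst src e :=
  if e is e'.+1 then Seq (Pow dst src e') (Do (NumOp Defs.Mul dst dst src))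
  else Do (NumConst dst 1).

Definition only x a s s' : Prop :=
  [/\ forall y, y != x -> num s' y = num s y, num s' x = a & vset s' = vset s].

Lemma only_set_num x a k s : only x a s (set_num x a (tick k s)).
Proof. by split=> // [y /negPf yx|]; rewrite /= ?yx ?eqxx. Qed.

Lemma ok_pow dst src e s b :
  dst != src -> bits (num s src) <= b ->
  ok (Pow dst src e) s (1 + e * (e.+1 * b ^ 2)) 1%R (only dst (num s src ^ e) s).
Proof.
move=> ds sb; have b0 : 0 < b by apply: leq_trans sb.
suff H e' : e' <= e ->
    ok (Pow dst src e') s (1 + e' * (e.+1 * b ^ 2)) 1%R (only dst (num s src ^ e') s).
  exact: H.
elim: e' => [_|e' IH le].
  by apply: (ok_det (s' := set_num dst 1 (tick 1 s))) => //; apply: only_set_num.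
apply: (@ok_le _ _ _ (1 + e' * (e.+1 * b ^ 2) + e.+1 * b ^ 2) _ 1%R) => //; last by lia.
apply: ok_seq (IH (ltnW le)) _ => s1 [o1 d1 v1].
pose c := bits (num s src ^ e') * bits (num s src).
apply: (ok_det (s' := set_num dst (num s src ^ e'.+1) (tick c s1))).
- by rewrite /instr_effect /= d1 o1 1?eq_sym // expnSr.
- by rewrite /= d1 o1 1?eq_sym.
- rewrite /= d1 o1 1?eq_sym // -mulnn mulnA leq_mul //.
  apply: leq_trans (bits_exp _ _) _.
  by have := leq_mul (ltnW le) sb; lia.
- split=> [y yd||] //=; last by rewrite eqxx.
  by rewrite (negPf yd) o1.
Qed.

(* Sets register 4 to [2 L] for an [L] with [n < 2 ^ L]. *)
Definition Init :=
  Seq (Do (NumCard 2 0)) (Seq (Do (NumConst 3 1)) (Seq (Do (NumConst 5 5))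
  (Seq (Do (NumOp Defs.Mul 5 5 2)) (Seq (Do (NumConst 6 1)) (Seq (Do (NumCard 7 0))
  (Seq (Repeat 7 (If (NumLe 6 2)
     (Seq (Do (NumOp Defs.Add 6 6 6)) (Do (NumOp Defs.Add 8 8 3))) Skip))
  (Do (NumOp Defs.Add 4 8 8)))))))).

Lemma ok_init t :
  ok Init (init_store G t) (30 * n * lgn ^ 2) 1%R (fun s =>
    [/\ num s 0 = t, ~~ answer s, num s 2 = n, vset s = vset (init_store G t)
      & exists L, [/\ n < 2 ^ L, L <= lgn & env L s]]).
Proof.
set s0 := init_store G t.
have c0 : #|vset s0 0| = n by rewrite /= cardsT.
apply: (@ok_le _ _ _ (lgn + (1 + (3 + (3 * lgn + (1 + (lgn +
  ((n * (6 * lgn ^ 2 + 2 * lgn) + lgn) + lgn ^ 2))))))) _ 1%R) => //; last first.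
  have := bits_gt0 n; move: n_gt0; move: n lgn => m b m0 b0.
  have : b <= b ^ 2 by rewrite -{1}(expn1 b) leq_pexp2l.
  have : b ^ 2 <= m * b ^ 2 by rewrite leq_pmull.
  have : m * b <= m * b ^ 2 by rewrite leq_mul2l -{1}(expn1 b) leq_pexp2l // orbT.
  lia.
pose s1 := set_num 2 n (tick lgn s0).
apply: (ok_do (s' := s1)); rewrite /= ?cardsT //.
pose s2 := set_num 3 1 (tick 1 s1).
apply: (ok_do (s' := s2)) => //.
pose s3 := set_num 5 5 (tick 3 s2).
apply: (ok_do (s' := s3)) => //.
pose s4 := set_num 5 (5 * n) (tick (3 * lgn) s3).
apply: (ok_do (s' := s4)) => //.
pose s5 := set_num 6 1 (tick 1 s4).
apply: (ok_do (s' := s5)) => //.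
pose s6 := set_num 7 n (tick lgn s5).
apply: (ok_do (s' := s6)); rewrite /= ?cardsT //.
pose J j s := [/\ forall x, x < 6 -> num s x = num s6 x, vset s = vset s6,
   num s 6 = 2 ^ num s 8, num s 8 = 0 \/ 2 ^ (num s 8).-1 <= n
   & n < 2 ^ num s 8 \/ num s 8 + j = n].
have small L : L = 0 \/ 2 ^ L.-1 <= n -> L <= lgn.
  case=> [->//|le]; rewrite /bits -ltnS.
  by case: L le => // L' le; rewrite !ltnS; apply: trunc_log_max.
have bits_small L : L <= lgn -> bits L <= lgn.
  move=> Ll; apply: leq_bits; apply: leq_trans Ll _.
  by apply: bits_leq => //; apply: ltn_expl.
apply: (@ok_seq _ _ _ _ _ _ _ (J 0)).
  apply: (@ok_le _ _ _ (num s6 7 * (6 * lgn ^ 2 + 2 * lgn) + lgn) _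
    (if answer s6 then 0 else 1 ^+ num s6 7)%R); last by rewrite expr1n.
  2: by [].
  apply: (ok_repeat (J := J)) => //.
  - by move=> j s [sx _ _ _ _]; rewrite sx.
  - move=> j s [sx sv p6 h8 h8'] _.
    have bL := small _ h8; have L8 := bits_small _ bL.
    set s' := set_num 7 j s.
    have sx' x : x < 6 -> num s' x = num s6 x.
      by move=> x6; rewrite -sx //= (_ : x == 7 = false) //; lia.
    have b6 : bits (num s' 6) <= lgn.+1.
      by apply: bits_leq => //; rewrite /= p6 ltn_exp2l ltnS.
    have e2 : num s' 2 = n by rewrite [num _ _]sx.
    have e3 : num s' 3 = 1 by rewrite [num _ _]sx.
    apply: (@ok_le _ _ _ (2 * lgn ^ 2 + (lgn ^ 2 + lgn)) _ 1%R) => //; last first.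
      by have := bits_gt0 n; move: lgn => b b0; rewrite -!mulnn; nia.
    apply: ok_if.
      rewrite /test_cost e2; have := bits_gt0 n; move: b6.
      by move: (bits (num s' 6)) lgn => a b; rewrite -mulnn; nia.
    set tc := test_cost _ _; rewrite /test_value e2.
    case: ifP => [le|gt]; last first.
      apply: (ok_le (B := 0) (r := 1%R)) => //; apply: ok_skip; split=> //.
      split=> //.
      left; rewrite -p6 ltnNge; apply/negP => le.
      by move/negP: gt; apply.
    have b6' : bits (num s' 6) <= lgn by apply: leq_bits.
    pose s1' := set_num 6 (2 ^ (num s 8).+1) (tick (bits (num s' 6) * bits (num s' 6)) (tick tc s')).
    apply: (ok_do (s' := s1')) => //.
    + by rewrite /s1' expnS mul2n -addnn -p6.
    + by rewrite /= -mulnn leq_mul.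
    apply: (ok_det (s' := set_num 8 (num s 8).+1 (tick (bits (num s 8)) s1'))).
    + by rewrite /= [num _ 3]e3 addn1 muln1.
    + by rewrite /= [num _ 3]e3 muln1.
    + by rewrite /= [num _ 3]e3 muln1.
    split=> //; split=> //.
    + by case=> [|[|[|[|[|[|]]]]]] // ?; apply: sx.
    + by right; rewrite -p6.
    + case: h8' => [|h]; first by rewrite -p6 ltnNge; move: le => /= ->.
      by right; rewrite /= addSnnS.
  - split=> //; [by left|by right].
move=> s [sx sv p6 h8 h8']; set L := num s 8 in p6 h8 h8'.
have nL : n < 2 ^ L by case: h8' => // <-; rewrite addn0 ltn_expl.
have Ll : L <= lgn by apply: small.
pose c := bits L * bits L.
apply: (ok_det (s' := set_num 4 L.*2 (tick c s))) => //.
- by rewrite /= addnn.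
- by rewrite /= -mulnn leq_mul // bits_small.
split=> //.
- by rewrite [num _ _]sx.
- by rewrite /answer [num _ _]sx.
- by rewrite [num _ _]sx.
- exists L; split=> //; split=> //.
  + by rewrite [num _ _]sx.
  + by rewrite [num _ _]sx.
  + by rewrite [vset _]sv.
Qed.

(* [n / m ^ (2 ^ i)] is the degree threshold after [i] steps; all thresholds
   must be at least 1, and their product must exceed [t]. *)
Definition fits k t m : bool := (m ^ (2 ^ k.-1) <= n) && (t * m ^ (2 ^ k - 1) < n ^ k).

Lemma fits_minn k t m : 0 < m -> fits k (minn t (n ^ k)) m = fits k t m.
Proof.
move=> m0; rewrite /fits; case: (leqP t (n ^ k)) => // le; congr (_ && _).
have x0 : 0 < m ^ (2 ^ k - 1) by rewrite expn_gt0 m0.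
have h : n ^ k <= t * m ^ (2 ^ k - 1) by apply: leq_trans (ltnW le) _; rewrite leq_pmulr.
by rewrite ltnNge leq_pmulr // ltnNge h.
Qed.

Definition Search k :=
  Seq (Pow 9 2 k) (Seq (If (NumLe 0 9) (Do (NumOp Defs.Mul 14 0 3)) (Do (NumOp Defs.Mul 14 9 3)))
  (Seq (Do (NumCard 10 0)) (Repeat 10
    (Seq (Do (NumOp Defs.Add 11 10 3)) (Seq (Pow 12 11 (2 ^ k.-1)) (Seq (Pow 13 11 (2 ^ k - 1))
    (Seq (Do (NumOp Defs.Mul 13 13 14))
    (If (NumLe 12 2) (If (NumLe 9 13) Skip (If (NumLe 11 8) Skip (Do (NumOp Defs.Mul 8 11 3))))
      Skip)))))))).

Lemma ok_search k t s :
  0 < k -> num s 0 = t -> num s 2 = n -> num s 3 = 1 -> num s 8 = 1 -> vset s 0 = setT ->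
  ok (Search k) s (bits t * (2 * 2 ^ k * lgn) + 32 * (2 ^ k) ^ 2 * n * lgn ^ 2) 1%R (fun s' =>
    [/\ forall x, x < 6 -> num s' x = num s x, vset s' = vset s, 0 < num s' 8,
        num s' 8 = 1 \/ fits k t (num s' 8) & ~~ fits k t (num s' 8).+1]).
Proof.
move=> k0 h0 h2 h3 h8 S0; set b := lgn; set e := 2 ^ k; set N := n ^ k.
have b0 : 0 < b by [].
have ke : k <= e by rewrite ltnW // ltn_expl.
have e0 : 0 < e by rewrite expn_gt0.
have e1 : 2 ^ k.-1 <= e by rewrite leq_pexp2l // leq_pred.
have e2 : 2 ^ k - 1 <= e by apply: leq_subr.
have e2p : 0 < 2 ^ k - 1 by rewrite subn_gt0 -{1}(expn0 2) ltn_exp2l.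
have bexp m d : m <= n -> d <= e -> bits (m ^ d) <= 2 * e * b.
  move=> mn de; apply: leq_trans (bits_exp _ _) _.
  have := leq_mul de (leq_bits mn); have := leq_mul e0 b0; rewrite -/b; lia.
have cpow d : d <= e -> 1 + d * (d.+1 * b ^ 2) <= 3 * e ^ 2 * b ^ 2.
  move=> de; have b2 : 0 < b ^ 2 by rewrite expn_gt0 b0.
  have := leq_mul (leq_mul de de) (leqnn (b ^ 2)); have := leq_mul de (leqnn (b ^ 2)).
  have := leq_mul (leq_mul e0 e0) b2; have := leq_mul (leq_mul e0 (leqnn e)) (leqnn (b ^ 2)).
  rewrite mulnn; lia.
apply: (@ok_le _ _ _ (3 * e ^ 2 * b ^ 2 + (bits t * (2 * e * b) + 2 * e * b +
  (b + (n * (23 * e ^ 2 * b ^ 2 + 2 * b) + b)))) _ 1%R) => //; last first.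
  have := leq_mul e0 b0; have := leq_mul n_gt0 (leqnn (e ^ 2 * b ^ 2)).
  have : b * 1 <= b ^ 2 * e ^ 2 by rewrite leq_mul ?expn_gt0 ?e0 // -{1}(expn1 b) leq_pexp2l.
  have : e * b <= e ^ 2 * b ^ 2.
    by rewrite leq_mul // -[X in X <= _]expn1 leq_pexp2l.
  have := leq_mul (leqnn n) (_ : b * 1 <= b ^ 2 * e ^ 2).
  rewrite leq_mul ?expn_gt0 ?e0 //; last by rewrite -{1}(expn1 b) leq_pexp2l.
  move/(_ isT); rewrite -/b; lia.
apply: ok_seq.
  apply: ok_le (@ok_pow _ _ k _ b _ _) _ _ => //; last exact: cpow.
  by rewrite h2.
rewrite h2 => s1 [o1 p1 v1].
pose t' := minn t N.
have bt' : bits t' <= 2 * e * b.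
  by apply: leq_trans (leq_bits (geq_minr _ _)) _; apply: bexp.
apply: (@ok_seq _ _ _ _ _ _ _ (fun s2 => [/\ forall y, y != 14 -> num s2 y = num s1 y,
   num s2 14 = t' & vset s2 = vset s1])).
  have n0 : num s1 0 = t by rewrite o1.
  have n3 : num s1 3 = 1 by rewrite o1.
  apply: ok_if; first by rewrite /= n0 p1 leq_mul2l bexp ?orbT.
  set tc := test_cost _ _.
  have -> : (if test_value (NumLe 0 9) s1 then Do (NumOp Defs.Mul 14 0 3)
     else Do (NumOp Defs.Mul 14 9 3)) = Do (NumOp Defs.Mul 14 (if t <= N then 0 else 9) 3).
    by rewrite /= n0 p1; case: ifP.
  have nt : num (tick tc s1) (if t <= N then 0 else 9) = t'.
    by rewrite /= /t'; case: leqP => _; rewrite ?n0 ?p1.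
  apply: (ok_det (s' := set_num 14 t' (tick (bits t') (tick tc s1)))).
  - by rewrite /instr_effect /instr_cost [num _ 3]n3 nt /arith_op muln1 [num _ 3]n3 [num _ _]nt muln1.
  - by rewrite /instr_cost nt [num _ 3]n3 muln1.
  - by rewrite /instr_cost nt [num _ 3]n3 muln1.
  - by split=> // y /negPf; rewrite /= => ->.
move=> s2 [o2 p2 v2].
have c2 : #|vset s2 0| = n by rewrite v2 v1 S0 cardsT.
pose s3 := set_num 10 n (tick b s2).
apply: (ok_do (s' := s3)); rewrite /= ?c2 //.
have x3 : num s3 10 = n by [].
have keep3 x : x < 6 -> num s3 x = num s x.
  by move=> x6; rewrite /= (_ : x == 10 = false) ?o2 ?o1 //; lia.
pose J j s' := [/\ forall x, x < 6 -> num s' x = num s x, vset s' = vset s, num s' 9 = N,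
   num s' 14 = t' & [/\ j <= n, 0 < num s' 8 <= n, num s' 8 = 1 \/ fits k t' (num s' 8)
   & forall i, j < i -> i <= n -> fits k t' i -> i <= num s' 8]].
apply: (@ok_weaken _ _ _ (num s3 10 * (23 * e ^ 2 * b ^ 2 + 2 * b) + b) _
    (if answer s3 then 0 else 1 ^+ num s3 10)%R _ (J 0)); last first.
- move=> s4 [k4 v4 _ _ [_ /andP[M0 Mn] M1 Mmax]]; split=> //.
    by case: M1 => [|f]; [left | right; rewrite -(fits_minn _ _ M0)].
  apply/negP => f; have f' := f; rewrite -fits_minn // in f'.
  have Mn' : (num s4 8).+1 <= n.
    case/andP: f => le _; apply: leq_trans le; rewrite -{1}(expn1 (num s4 8).+1).
    by rewrite leq_pexp2l // expn_gt0.
  by have := Mmax (num s4 8).+1 isT Mn' f'; rewrite ltnn.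
- by rewrite expr1n; case: ifP.
- by rewrite x3.
apply: (ok_repeat (J := J)) => //.
- by move=> j s4 [k4 _ _ _ _]; rewrite k4.
- move=> j s' [k' v' n9 n14 [jn /andP[M0 Mn] M1 Mmax]] _.
  set M := num s' 8 in M0 Mn M1 Mmax; set c := j.+1 in jn Mmax.
  have bc : bits c <= b by apply: leq_bits.
  have m2 : num s' 2 = n by rewrite k'.
  have m3 : num s' 3 = 1 by rewrite k'.
  apply: (@ok_le _ _ _ (b + (3 * e ^ 2 * b ^ 2 + (3 * e ^ 2 * b ^ 2 + (4 * e ^ 2 * b ^ 2 +
    (2 * e * b * b + (2 * e * b * (4 * e * b) + (b * b + b))))))) _ 1%R) => //; last first.
    have : b * 1 <= b ^ 2 * e ^ 2 by rewrite leq_mul ?expn_gt0 ?e0 // -{1}(expn1 b) leq_pexp2l.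
    have : e * b ^ 2 <= e ^ 2 * b ^ 2.
      by rewrite leq_mul // -[X in X <= _]expn1 leq_pexp2l.
    have := leq_mul (leqnn (b ^ 2)) (_ : 1 <= e ^ 2).
    rewrite expn_gt0 e0 => /(_ isT); lia.
  pose a1 := set_num 11 c (tick (bits j) (set_num 10 j s')).
  apply: (ok_do (s' := a1)).
  + by rewrite /= m3 muln1 addn1.
  + by rewrite /= m3 muln1.
  + by rewrite /= m3 muln1; apply: leq_trans bc; apply: leq_bits.
  have c1 : num a1 11 = c by [].
  apply: ok_seq.
    by apply: ok_le (@ok_pow _ _ (2 ^ k.-1) _ b _ _) _ _ => //; apply: cpow.
  rewrite c1 => a2 [q2 U2 w2].
  have c2' : num a2 11 = c by rewrite q2.
  apply: ok_seq.
    apply: ok_le (@ok_pow _ _ (2 ^ k - 1) _ b _ _) _ _ => //; last exact: cpow.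
    by rewrite c2'.
  rewrite c2' => a3 [q3 V3 w3].
  have V14 : num a3 14 = t' by rewrite q3 // q2.
  set x := c ^ (2 ^ k - 1) in V3.
  have bx : bits x <= 2 * e * b by apply: bexp.
  pose a4 := set_num 13 (x * t') (tick (bits x * bits t') a3).
  apply: (ok_do (s' := a4)).
  + by rewrite /instr_effect /instr_cost V3 V14 [num _ 13]V3 [num _ 14]V14.
  + by rewrite /instr_cost V3 V14.
  + rewrite /instr_cost V3 V14 (_ : 4 * e ^ 2 * b ^ 2 = 2 * e * b * (2 * e * b)); last by ring.
    exact: leq_mul.
  have U4 : num a4 12 = c ^ (2 ^ k.-1) by rewrite /= q3.
  have W4 : num a4 13 = x * t' by [].
  have N4 : num a4 9 = N by rewrite /= q3 // q2.
  have M4 : num a4 8 = M by rewrite /= q3 // q2.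
  have c4 : num a4 11 = c by rewrite /= q3.
  have k4 y : y < 6 -> num a4 y = num s y.
    by case: y => [|[|[|[|[|[|]]]]]] // y6; rewrite /= q3 // q2 //= k'.
  have f4 : fits k t' c = (num a4 12 <= n) && (num a4 13 < N).
    by rewrite /fits U4 W4 mulnC.
  have n4 : num a4 2 = n by rewrite k4.
  have stop M' : M' = (if fits k t' c && (M < c) then c else M) ->
      forall a5, (forall y, y != 8 -> num a5 y = num a4 y) -> vset a5 = vset a4 ->
      num a5 8 = M' ->
      [/\ J j a5, num a5 10 = j & answer s' -> answer a5].
    move=> eM a5 o5 v5 m5; have e5 y : y < 6 -> num a5 y = num s y.
      by move=> y6; rewrite o5 ?k4 //; lia.
    split.
    - split; first exact: e5.
      + by rewrite v5 /= w3 w2.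
      + by rewrite o5.
      + by rewrite o5 //= q3 // q2.
      + rewrite m5 {m5}eM; case: ifP => [/andP[fc Mc]|nf]; split; rewrite ?(ltnW jn) ?M0 ?jn //.
        * by right.
        * move=> i ji iN fi; case: (ltnP c i) => [ci|//].
          by have := leq_trans (Mmax i ci iN fi) (ltnW Mc); rewrite leqNgt ci.
        * move=> i ji iN fi; case: (ltnP c i) => [ci|ic]; first exact: Mmax.
          have ei : i = c by apply/eqP; rewrite eqn_leq ic ji.
          by move: nf; rewrite -ei fi /= ltnNge => /negbFE.
    - by rewrite o5 // /= q3 // q2.
    - by rewrite /answer (e5 1 isT) (k' 1 isT).
  clearbody a4.
  apply: ok_if.
    by rewrite /= n4 U4 leq_mul // bexp.
  rewrite /= n4; case: ifP => hU; last first.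
    apply: (ok_le (B := 0) (r := 1%R)) => //; apply: ok_skip.
    by apply: (stop M) => //; rewrite f4 hU.
  apply: ok_if.
    rewrite /= N4 W4 leq_mul ?bexp //.
    by apply: leq_trans (bits_mul _ _) _; lia.
  rewrite /= N4; case: ifP => hV.
    apply: (ok_le (B := 0) (r := 1%R)) => //; apply: ok_skip.
    by apply: (stop M) => //; rewrite f4 hU ltnNge hV.
  apply: ok_if.
    by rewrite /= c4 M4 leq_mul // leq_bits.
  rewrite /= c4 M4; case: ifP => hM.
    apply: (ok_le (B := 0) (r := 1%R)) => //; apply: ok_skip.
    by apply: (stop M) => //; rewrite ltnNge hM andbF.
  set s7 := tick _ _.
  have e7 : num s7 11 = c by [].
  have e73 : num s7 3 = 1 by rewrite [num _ _]k4.
  apply: (ok_det (s' := set_num 8 c (tick (bits c) s7))).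
  + by rewrite /instr_effect /instr_cost e7 e73 [num _ 11]e7 [num _ 3]e73 /= !muln1.
  + by rewrite /instr_cost e7 e73 muln1.
  + by rewrite /instr_cost e7 e73 muln1.
  apply: (stop c) => //; first by rewrite f4 hU ltnNge hV /= ltnNge hM.
  by move=> y /negPf y8; rewrite /= y8.
- split=> //.
  + by rewrite /= v2 v1.
  + by rewrite /= o2 // p1.
  + have e8 : num s3 8 = 1 by rewrite /= o2 // o1.
    rewrite e8; split=> //; [by left | by move=> i; rewrite x3; lia].
Qed.

End Setup.

Section Main.

Variable G : sgraph.
Local Open Scope nat_scope.
Implicit Types (s : store G) (tau : 'I_3 -> G) (l : seq ('I_3 * 'I_3)).

Notation n := #|G|.
Notation lgn := (bits #|G|).

Hypothesis n_gt0 : 0 < n.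

(* With no vertex to delete, a single step with threshold [n] is an exhaustive
   search. *)
Definition nonempty_steps l : seq ('I_3 * 'I_3) :=
  if l is [::] then [:: (ord0, ord_max)] else l.

Definition Main l : program :=
  Seq Init (Seq (Do (NumConst 8 1)) (Seq (if l is [::] then Skip else Search (size l))
  (Seq (Do (SetCopy 8 0)) (Seq (Do (SetCopy 9 0)) (Seq (Do (SetCopy 10 0))
  (Level 8 (nonempty_steps l))))))).

Definition scale_ok l t M : bool :=
  if l is [::] then M == 1
  else [&& 0 < M, (M == 1) || fits G (size l) t M & ~~ fits G (size l) t M.+1].

Definition search_cost l t : nat :=
  if l is [::] then 0
  else bits t * (2 * 2 ^ size l * lgn) + 32 * (2 ^ size l) ^ 2 * n * lgn ^ 2.

Lemma triangle_of : has_triangle G -> exists tau, triangle tau.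
Proof.
case/existsP=> x /existsP[y /existsP[z /and3P[xy yz xz]]].
exists (fun c : 'I_3 => tnth [tuple x; y; z] c) => c d.
case: c => [[|[|[|//]]] ?]; case: d => [[|[|[|//]]] ?] //= _; rewrite !(tnth_nth x) //=;
  by rewrite adj_sym.
Qed.

Lemma ok_main l t B :
  all (fun ab => ab.1 != ab.2) l ->
  (forall tau, triangle tau -> runs tau l (fun _ => [set: G]) <= t) ->
  (forall M, scale_ok l t M -> level_cost G (nonempty_steps l) M <= B) ->
  ok (Main l) (init_store G t)
     (30 * n * lgn ^ 2 + (1 + (search_cost l t + (3 * (2 * n + 1) + B))))
     (if has_triangle G then n%:R^-1 else 1)%R
     (fun s => answer s -> has_triangle G).
Proof.
move=> neq few HB.
apply: ok_seq (ok_init n_gt0 t) _ => s1 [t1 a1 n1 S1 [L [nL Ll env1]]].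
have [e3 e4 e5 E1] := env1.
pose s2 := set_num 8 1 (tick 1 s1).
apply: (ok_do (s' := s2)) => //.
apply: (@ok_seq _ _ _ _ _ _ _ (fun s' => [/\ forall x, x < 6 -> num s' x = num s1 x,
    vset s' = vset s1 & exists M, [/\ num s' 8 = M, scale_ok l t M
       & M = 1 \/ l != [::] /\ fits G (size l) t M]])).
  case: l {neq few HB} => [|ab l].
    apply: (ok_le (B := 0) (r := 1%R)) => //; apply: ok_skip.
    split=> //; last by exists 1; split=> //; left.
    by case=> [|[|[|[|[|[|]]]]]].
  apply: (ok_post (@ok_search _ n_gt0 _ t _ _ _ _ _ _ _)) => //; first by rewrite /= S1.
  move=> s3 [k3 v3 M0 M1 M2]; split=> //.
    by case=> [|[|[|[|[|[|]]]]]] // _; rewrite k3.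
  exists (num s3 8); split=> //; last by case: M1; [left | right].
  rewrite /scale_ok; apply/and3P; split=> //.
  by case: M1 => ->; rewrite ?eqxx ?orbT.
move=> s3 [k3 v3 [M [M8 ok3 M1]]].
have cs : #|[set: G]| = n by rewrite cardsT.
have S0 : vset s3 0 = setT by rewrite v3 S1.
have Sx x : x \in [:: 8; 9; 10] -> vset s3 x = set0.
  by rewrite v3 S1 !inE => /or3P[] /eqP->.
have cost x s : vset s x = set0 -> vset s 0 = setT -> instr_cost (SetCopy x 0) s <= 2 * n + 1.
  by move=> h1 h2; rewrite /instr_cost h1 h2 cards0 cs; lia.
rewrite (_ : 3 * (2 * n + 1) + B = 2 * n + 1 + (2 * n + 1 + (2 * n + 1 + B))); last by lia.
pose s4 := set_vset 8 (vset s3 0) (tick (instr_cost (SetCopy 8 0) s3) s3).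
apply: (ok_do (s' := s4)) => //; first exact: cost (Sx 8 isT) S0.
pose s5 := set_vset 9 (vset s4 0) (tick (instr_cost (SetCopy 9 0) s4) s4).
apply: (ok_do (s' := s5)) => //; first exact: cost (Sx 9 isT) S0.
pose s6 := set_vset 10 (vset s5 0) (tick (instr_cost (SetCopy 10 0) s5) s5).
apply: (ok_do (s' := s6)) => //; first exact: cost (Sx 10 isT) S0.
have e6 : env L s6.
  split; rewrite /= ?k3 //; by rewrite v3.
have M0 : 0 < M by move: ok3; case: (l) => [/eqP->|ab l' /and3P[]].
have F6 (c : 'I_3) : vset s6 (8 + c) = setT.
  by case: c => [[|[|[|//]]] ?]; rewrite /= S0.
apply: (@ok_weaken _ _ _ (level_cost G (nonempty_steps l) M) _
  (if has_triangle G then n%:R^-1 else 1)%R _ (frame (8 + 3) s6)).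
- apply: (ok_level n_gt0 nL Ll (q := M)) => //.
  + by case: (l) neq.
  + move=> _; case: M1 => [->|[l0 /andP[h _]]]; first by rewrite exp1n.
    by case: (l) l0 h.
  + case: ifP => tri; [right; split=> // | by left].
    have [tau ttau] := triangle_of tri; exists tau; split=> // [c|]; first by rewrite F6 inE.
    case: M1 => [->|[l0 /andP[_ f]]]; first by left; split=> //; case: (l).
    right; rewrite (eq_runs _ _ F6) (_ : nonempty_steps l = l); last by case: (l) l0.
    by apply: leq_ltn_trans f; rewrite leq_mul2r few ?orbT.
- exact: HB.
- by [].
- move=> s7 [_ _ _ _ h] /h [a6|//]; case/negP: a1.
  by rewrite /answer -(k3 1 isT); exact: a6.
Qed.

End Main.

Section NiceColoring.

Variable H : sgraph.
Local Open Scope nat_scope.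

Lemma deletes_to_triangle (col : H -> 'I_3) (T R : {set H}) x y z :
  proper_coloring col -> adj x y -> adj y z -> adj x z ->
  deletes_to col T R -> [set x; y; z] \subset T -> [set x; y; z] \subset R.
Proof.
move=> proper xy yz xz; elim=> [//|S R' v /andP[vS /forall_inP mono] _ IH sub]; apply: IH.
have inS u : u \in [set x; y; z] -> u \in S by apply: (subsetP sub).
have two a b : adj v a -> adj v b -> adj a b -> a \in S -> b \in S -> False.
  move=> va vb /proper /negP ab aS bS; case: ab.
  by have /forall_inP/(_ b bS)/implyP/(_ va)/implyP/(_ vb) := mono a aS.
have [xS yS zS] : [/\ x \in S, y \in S & z \in S].
  by split; apply: inS; rewrite !inE eqxx ?orbT.
apply/subsetP => u uT; rewrite in_setD1 inS // andbT; apply/eqP => uv.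
rewrite uv !inE in uT; case/orP: uT => [/orP[]|] /eqP e; rewrite e in two.
- by apply: (two y z).
- by apply: (two x z); rewrite // adj_sym.
- by apply: (two x y); rewrite // adj_sym.
Qed.

Lemma induces_triangleP (R : {set H}) : induces_triangle R -> has_triangle H.
Proof.
case/andP=> R3 /forall_inP all.
have ad x y : x \in R -> y \in R -> x != y -> adj x y.
  by move=> xR yR xy; have /forall_inP/(_ y yR)/implyP := all x xR; apply.
have /card_gt0P[x xR] : 0 < #|R| by rewrite (eqP R3).
have : #|R :\ x| == 2 by move: R3; rewrite (cardsD1 x) xR.
case/cards2P=> y [z [yz e]].
have /setD1P[yx yR] : y \in R :\ x by rewrite e !inE eqxx.
have /setD1P[zx zR] : z \in R :\ x by rewrite e !inE eqxx orbT.
apply/existsP; exists x; apply/existsP; exists y; apply/existsP; exists z.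
by rewrite !ad // eq_sym.
Qed.

Lemma nice_steps : has_nice_coloring H -> exists l : seq ('I_3 * 'I_3),
  [/\ all (fun ab => ab.1 != ab.2) l,
      #|H| = size l + (if has_triangle H then 3 else 0)
    & forall (G : sgraph) (tau : 'I_3 -> G), triangle tau ->
        runs tau l (fun _ => [set: G]) <= num_copies H G].
Proof.
case=> col [proper [R [del _ left]]].
have [l [dl un dis cover]] := deletes_to_deletion proper del.
have cardH : #|H| = #|R| + size l.
  rewrite -cardsT cover cardsU disjoint_setI0 ?cards0 ?subn0.
    by congr (_ + _); rewrite cardsE; move/card_uniqP: un => ->; rewrite size_map.
  apply/pred0P => z; apply/negP => /andP[/= zR]; rewrite inE => zl.
  by move: (disjointFr dis zR); rewrite zl.
have adR : {in R &, forall x y, x != y -> adj x y}.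
  case: left => [->|/andP[_ /forall_inP all]] x y; first by rewrite inE.
  by move=> xR yR; have /forall_inP/(_ y yR)/implyP := all x xR.
exists (colors col l); split.
- elim: l dl {un dis cover cardH} => [//|[x beta] l IH] [_ _ xb _ /IH] /= ->.
  by rewrite xb.
- rewrite size_map cardH addnC; congr (_ + _).
  case: ifP => [/existsP[x /existsP[y /existsP[z /and3P[xy yz xz]]]]|no].
    case: left => [R0|/andP[/eqP->]//].
    have := deletes_to_triangle proper xy yz xz del (subsetT _).
    by move/subsetP/(_ x); rewrite R0 !inE eqxx => /(_ isT).
  by case: left => [->|/induces_triangleP]; rewrite ?cards0 ?no.
- move=> G tau tri; apply: (runs_le_copies dl) => // x y xR yR e.
  by apply/eqP/negPn/negP => /(adR x y xR yR)/proper; rewrite e eqxx.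
Qed.

End NiceColoring.

(** * Running time *)

Section RunningTime.

Variable R : realType.
Local Open Scope ring_scope.

Lemma bits_le_ln n : (0 < n)%N -> (bits n)%:R <= 2 * (1 + ln n%:R) :> R.
Proof.
move=> n0; have n1 : (0 : R) < n%:R by rewrite ltr0n.
have ln2 : 2^-1 <= ln 2 :> R.
  rewrite -[2^-1]expRK ler_ln ?posrE ?expR_gt0 //.
  have h : 2^-1 <= expR (- 2^-1) :> R by apply: le_trans (expR_ge1Dx _); lra.
  by move: h; rewrite expRN lef_pV2 ?posrE ?expR_gt0.
have lnn : (trunc_log 2 n)%:R * ln 2 <= ln n%:R :> R.
  rewrite -[X in X <= _](_ : ln (2 ^+ trunc_log 2 n) = _); last by rewrite lnXn // mulr_natl.
  by rewrite ler_ln ?posrE ?exprn_gt0 // -natrX ler_nat trunc_logP.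
have t0 : (0 : R) <= (trunc_log 2 n)%:R by [].
by rewrite /bits -natr1; nra.
Qed.

Lemma time_triangle_shift k (n t : R) :
  time_triangle (k + 3)%:R n t = time_triangle_free k%:R n t.
Proof.
rewrite /time_triangle /time_triangle_free natrD.
have -> : k%:R + 3%:R - 4 = k%:R - 1 :> R by ring.
by have -> : k%:R + 3%:R - 3 = k%:R :> R by ring.
Qed.

Definition time_nat (k n t : nat) : R :=
  n%:R `^ (3 - (2 ^ k.-1)%:R^-1) +
  n%:R `^ (3 - k%:R / (2 ^ k - 1)%:R) * t%:R `^ ((2 ^ k - 1)%:R^-1).

Lemma time_natE k n t : (0 < k)%N -> time_triangle_free k%:R n%:R t%:R = time_nat k n t.
Proof.
move=> k0; rewrite /time_triangle_free /time_nat !div1r.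
have -> : k%:R - 1 = k.-1%:R :> R by rewrite -[in LHS](prednK k0) -natr1 addrK.
by rewrite !powR_mulrn // -!natrX natrB ?expn_gt0.
Qed.

Variables (k n t : nat).
Hypotheses (k_gt0 : (0 < k)%N) (n_gt0 : (0 < n)%N).

Let e1 := (2 ^ k.-1)%N.
Let e2 := (2 ^ k - 1)%N.

Lemma e2_gt0 : (0 < e2)%N.
Proof. by rewrite subn_gt0 -{1}(expn0 2) ltn_exp2l. Qed.

Lemma e1_gt0 : (0 < e1)%N.
Proof. by rewrite expn_gt0. Qed.

Lemma k_le_e2 : (k <= e2)%N.
Proof. by rewrite -ltnS /e2 subn1 prednK ?expn_gt0 // ltn_expl. Qed.

Lemma natr_rootE (b d : nat) : (0 < d)%N -> b%:R = (b ^ d)%:R `^ d%:R^-1 :> R.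
Proof.
move=> d0; rewrite natrX -powR_mulrn // -powRrM mulfV ?powRr1 //.
by rewrite pnatr_eq0 -lt0n.
Qed.

Lemma root_le (a b d : nat) : (0 < d)%N -> (a <= b ^ d)%N -> a%:R `^ d%:R^-1 <= b%:R :> R.
Proof.
by move=> d0 ab; rewrite (natr_rootE b d0) ge0_ler_powR ?nnegrE ?ler_nat ?invr_ge0.
Qed.

Lemma root_ge (a b d : nat) : (0 < d)%N -> (b ^ d <= a)%N -> b%:R <= a%:R `^ d%:R^-1 :> R.
Proof.
by move=> d0 ab; rewrite (natr_rootE b d0) ge0_ler_powR ?nnegrE ?ler_nat ?invr_ge0.
Qed.

Let n1 : 1 <= n%:R :> R. Proof. by rewrite ler1n. Qed.
Let n0 : 0 < n%:R :> R. Proof. by rewrite ltr0n. Qed.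

Lemma n_le_time : n%:R <= time_nat k n t.
Proof.
rewrite /time_nat ler_wpDr ?mulr_ge0 ?powR_ge0 // -[X in X <= _]powRr1 // ler_powR //.
have : e1%:R^-1 <= 1 :> R by rewrite invf_le1 ?ltr0n ?ler1n ?e1_gt0.
rewrite -/e1; lra.
Qed.

Lemma bits_le_time : (bits t)%:R <= e2%:R * time_nat k n t.
Proof.
have e20 : 1 <= e2%:R :> R by rewrite ler1n e2_gt0.
have [t0|t0] := posnP t.
  rewrite {1}t0 /bits trunc_log0 -[1%:R]mul1r ler_pM //.
  exact: le_trans n1 n_le_time.
apply: (@le_trans _ _ (e2%:R * t%:R `^ e2%:R^-1)).
  pose b := trunc_log 2 t.
  apply: (@le_trans _ _ (e2%:R * (2 ^ (b %/ e2))%:R)).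
    rewrite -natrM ler_nat /bits -/b.
    apply: (leq_trans (ltn_ceil b e2_gt0)); rewrite mulnC leq_mul2l ltn_expl ?orbT //.
  rewrite ler_wpM2l //; apply: root_ge e2_gt0 _; rewrite -expnM.
  by apply: leq_trans (trunc_logP (isT : (1 < 2)%N) t0); rewrite leq_pexp2l // leq_divM.
rewrite ler_wpM2l // /time_nat -/e1 -/e2 ler_wpDl ?powR_ge0 // ler_peMl ?powR_ge0 //.
rewrite -[X in X <= _](powRr0 n%:R) ler_powR //.
have : k%:R / e2%:R <= 1 :> R by rewrite ler_pdivrMr ?ltr0n ?e2_gt0 // mul1r ler_nat k_le_e2.
lra.
Qed.

Lemma cube_le_time M : (0 < M)%N ->
  ~~ ((M.+1 ^ e1 <= n) && (t * M.+1 ^ e2 < n ^ k))%N ->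
  (n ^ 3)%:R <= 2 * M%:R * time_nat k n t.
Proof.
move=> M0 no; have M2 : M.+1%:R <= 2 * M%:R :> R by rewrite -natrM ler_nat; lia.
have cube (x : R) : n%:R ^+ 3 = n%:R `^ (3 - x) * n%:R `^ x.
  rewrite -powRD; first by rewrite subrK powR_mulrn.
  by rewrite (gt_eqF n0) implybT.
rewrite natrX; move: no; rewrite negb_and -ltnNge -leqNgt => /orP[lt|le].
  have h := root_le e1_gt0 (ltnW lt).
  rewrite (cube (e1%:R^-1)) mulrC /time_nat -/e1 -/e2.
  apply: ler_pM; rewrite ?powR_ge0 //; first exact: le_trans h M2.
  by rewrite ler_wpDr ?mulr_ge0 ?powR_ge0.
have h : n%:R `^ (k%:R / e2%:R) <= t%:R `^ e2%:R^-1 * M.+1%:R :> R.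
  rewrite powRrM powR_mulrn // -natrX.
  apply: (@le_trans _ _ ((t * M.+1 ^ e2)%:R `^ e2%:R^-1 : R)).
    by rewrite ge0_ler_powR ?nnegrE ?ler_nat ?invr_ge0.
  rewrite natrM powRM // ler_wpM2l ?powR_ge0 //.
  exact: root_le e2_gt0 (leqnn _).
rewrite (cube (k%:R / e2%:R)) /time_nat -/e1 -/e2.
have h2 := le_trans h (ler_wpM2l (powR_ge0 _ _) M2).
apply: le_trans (ler_wpM2l (powR_ge0 _ _) h2) _.
rewrite mulrA mulrC; apply: ler_wpM2l; first by rewrite mulr_ge0.
by rewrite ler_wpDl ?powR_ge0.
Qed.

End RunningTime.

Section TotalCost.

Variables (R : realType) (G : sgraph) (l : seq ('I_3 * 'I_3)) (t : nat).
Local Open Scope ring_scope.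

Notation n := #|G|.
Notation lgn := (bits #|G|).

Hypothesis n_gt0 : (0 < n)%N.

Let tm : R := time_triangle_free (size l)%:R n%:R t%:R.

Let tm_ge0 : 0 <= tm.
Proof. by rewrite addr_ge0 ?mulr_ge0 ?powR_ge0. Qed.

Lemma time_nil (n' t' : R) : 0 <= n' -> time_triangle_free 0 n' t' = n' + n' `^ 3.
Proof.
move=> n'0; rewrite /time_triangle_free powRr0 subrr invr0 !mul0r subr0 mulr0 powRr0 mulr1.
rewrite sub0r powR_inv1 // invrK mul1r.
by rewrite (_ : 3 - 2 = 1) ?powRr1 //; ring.
Qed.

Let n_le_tm : n%:R <= tm.
Proof.
rewrite /tm; case: (posnP (size l)) => [->|k0]; last by rewrite time_natE // n_le_time.
by rewrite time_nil // ler_wpDr ?powR_ge0.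
Qed.

Lemma scale_ok_leq M : scale_ok G l t M -> (M ^ 2 ^ (size (nonempty_steps l)).-1 <= n)%N.
Proof.
rewrite /scale_ok /nonempty_steps; case: (l) => [/eqP->|ab l' /and3P[_ /orP[/eqP->|/andP[le _]] _]].
- by rewrite exp1n.
- by rewrite exp1n.
- exact: le.
Qed.

Lemma cube_le_tm M : scale_ok G l t M -> (n ^ 3)%:R <= 2 * M%:R * tm.
Proof.
rewrite /tm /scale_ok; case: l => [/eqP->|ab l' /and3P[M0 _]].
  rewrite time_nil // natrX powR_mulrn //.
  have h1 : 0 <= n%:R :> R by [].
  have h2 : 0 <= n%:R ^+ 3 :> R by rewrite exprn_ge0.
  by rewrite mulr1 mulrDr ler_wpDl ?mulr_ge0 // ler_peMl // ler1n.
by move=> no; rewrite time_natE //; apply: cube_le_time.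
Qed.

Lemma level_cost_le_tm M : scale_ok G l t M ->
  (level_cost G (nonempty_steps l) M)%:R <=
  2 * (level_const (size (nonempty_steps l)) * lgn ^ (3 * size (nonempty_steps l)))%:R * tm.
Proof.
move=> ok; have M0 : (0 < M)%N.
  by move: ok; rewrite /scale_ok; case: (l) => [/eqP->|ab l' /and3P[]].
have := level_cost_bound (l := nonempty_steps l) n_gt0 M0 (fun _ => scale_ok_leq ok).
move: (level_cost _ _ _) (_ * lgn ^ _)%N => x y; rewrite -(ler_nat R) natrM [(y * _)%:R]natrM => h.
have M1 : 0 < M%:R :> R by rewrite ltr0n.
rewrite -(ler_pM2r M1); apply: (le_trans h).
rewrite [leRHS](_ : _ = y%:R * (2 * M%:R * tm)); last by ring.
by apply: ler_wpM2l => //; apply: cube_le_tm.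
Qed.

Lemma search_cost_le_tm :
  (search_cost G l t)%:R <= (34 * (2 ^ size l) ^ 2 * lgn ^ 2)%:R * tm.
Proof.
rewrite /search_cost; case E: l => [|ab l']; first by rewrite mulr_ge0.
rewrite -E; have k0 : (0 < size l)%N by rewrite E.
have hb : (bits t)%:R <= (2 ^ size l)%:R * tm.
  rewrite /tm time_natE //; apply: le_trans (bits_le_time R t k0 n_gt0) _.
  apply: ler_wpM2r; last by rewrite ler_nat leq_subr.
  by rewrite -time_natE //; apply: tm_ge0.
have b1 : 1 <= lgn%:R :> R by rewrite ler1n.
rewrite !(natrM, natrD, natrX); move: hb n_le_tm tm_ge0.
rewrite natrX; set e := 2%:R ^+ size l; set b := lgn%:R; set m := n%:R; set u := (bits t)%:R.
move=> hb nt t0.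
have e0 : 0 <= e by rewrite exprn_ge0.
have b0 : 0 <= b by lra.
have bb : b <= b ^+ 2 by rewrite expr2 ler_peMl.
have h1 : u * (2%:R * e * b) <= e * tm * (2%:R * e * b ^+ 2).
  by apply: ler_pM => //; rewrite ?mulr_ge0 // ler_wpM2l ?mulr_ge0.
have h2 : 32%:R * e ^+ 2 * m * b ^+ 2 <= 32%:R * e ^+ 2 * tm * b ^+ 2.
  by rewrite ler_wpM2r ?exprn_ge0 // ler_wpM2l // mulr_ge0 ?exprn_ge0.
apply: le_trans (lerD h1 h2) _; rewrite le_eqVlt; apply/orP; left; apply/eqP; ring.
Qed.

Lemma total_cost_bound : exists B : nat,
  (forall M, scale_ok G l t M -> (level_cost G (nonempty_steps l) M <= B)%N) /\
  (30 * n * lgn ^ 2 + (1 + (search_cost G l t + (3 * (2 * n + 1) + B))))%:R <=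
  (40 + 34 * (2 ^ size l) ^ 2 + 2 * level_const (size (nonempty_steps l)))%:R
    * lgn%:R ^+ (3 * size (nonempty_steps l) + 2) * tm :> R.
Proof.
exists (\max_(M < n.+1 | scale_ok G l t M) level_cost G (nonempty_steps l) M)%N; split.
  move=> M ok; have Mn : (M < n.+1)%N.
    rewrite ltnS; apply: leq_trans (scale_ok_leq ok).
    rewrite -{1}(expn1 M); case: M ok => [|M] ok; last by rewrite leq_pexp2l // expn_gt0.
    by rewrite expn1.
  exact: (@leq_bigmax_cond _ (fun M : 'I_n.+1 => scale_ok G l t M) _ (Ordinal Mn)).
set B := (\max_(M < n.+1 | _) _)%N; set K := level_const _.
have hB : B%:R <= 2 * (K * lgn ^ (3 * size (nonempty_steps l)))%:R * tm.
  apply: (big_ind (fun x : nat => x%:R <= 2 * (K * lgn ^ (3 * size (nonempty_steps l)))%:R * tm)).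
  - by rewrite !mulr_ge0.
  - by move=> x y hx hy; rewrite /maxn; case: ifP.
  - by move=> M; apply: level_cost_le_tm.
move: hB search_cost_le_tm n_le_tm tm_ge0.
rewrite !(natrD, natrM, natrX) exprD.
set e := 2%:R ^+ size l; set b := lgn%:R; set m := n%:R.
set p := b ^+ (3 * _); set sc := (search_cost _ _ _)%:R.
move=> hB hs nt t0; have b1 : 1 <= b by rewrite ler1n.
have m1 : 1 <= m by rewrite ler1n.
have p1 : 1 <= p by apply: exprn_ege1.
have b2 : 1 <= b ^+ 2 by apply: exprn_ege1.
have p0 : 0 <= p by lra.
have b20 : 0 <= b ^+ 2 by lra.
have K0 : 0 <= K%:R :> R by [].
have e0 : 0 <= e ^+ 2 by rewrite !exprn_ge0.
set X := p * b ^+ 2 * tm.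
have X1 : b ^+ 2 * tm <= X by rewrite /X -mulrA ler_peMl // mulr_ge0.
have X2 : p * tm <= X by rewrite /X mulrAC ler_peMr // mulr_ge0.
have X3 : tm <= X by apply: le_trans X1; rewrite ler_peMl.
have h1 : m * b ^+ 2 <= X.
  by apply: le_trans X1; rewrite mulrC ler_wpM2l.
have h2 := ler_wpM2l e0 X1; have h3 := ler_wpM2l K0 X2.
have -> : (40%:R + 34%:R * e ^+ 2 + 2%:R * K%:R) * (p * b ^+ 2) * tm
    = 40 * X + 34 * (e ^+ 2 * X) + 2 * (K%:R * X) by rewrite /X; ring.
have h4 : sc <= 34 * (e ^+ 2 * (b ^+ 2 * tm)) by apply: le_trans hs _; rewrite !mulrA.
have h5 : B%:R <= 2 * (K%:R * (p * tm)) by apply: le_trans hB _; rewrite !mulrA.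
lra.
Qed.

End TotalCost.

Section Decision.

Variables (R : realType) (G : sgraph).
Local Open Scope ring_scope.

Lemma ok_decides p t B (r err : rat) (T : R) :
  ok p (init_store G t) B (if has_triangle G then r else 1)
     (fun s => answer s -> has_triangle G) ->
  B%:R <= T -> r <= err -> 0 <= err -> decides_triangle G p t T err.
Proof.
move=> [f [d [E F M L]]] BT rerr err0; exists f; rewrite /= E //; split.
  elim: d F {E M L} => [//|[w s] d IH FF]; have [_ /= cs _] := List.Forall_inv FF.
  rewrite /= IH ?andbT; last exact: List.Forall_inv_tail FF.
  by apply: le_trans BT; rewrite ler_nat; apply: cs.
have -> : dprob (some_dist d) (fun o => if o is Some s then answer s == has_triangle G else false) =
    mass d - (if has_triangle G then fail d else 0).
  rewrite /dprob big_map /=; case: ifP => tri.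
    have -> : mass d = \sum_(q <- d | answer q.2) q.1 + fail d.
      by rewrite /mass (bigID (fun q => answer q.2)).
    by rewrite addrK; apply: eq_bigl => q; case: answer.
  rewrite subr0 /mass; elim: d F {E M L} => [|q d IH F]; first by rewrite !big_nil.
  have [_ _ aq] := List.Forall_inv F.
  rewrite !big_cons IH; last exact: List.Forall_inv_tail F.
  by case: answer aq => // /(_ isT); rewrite tri.
rewrite M; case: (has_triangle G) L => L; lra.
Qed.

End Decision.

Theorem theorem1p11 (R : realType) (H : sgraph) (Hnice : has_nice_coloring H) :
  exists (p : program) (C c : nat),
    forall (G : sgraph) (t : nat),
      let n := #|G| in
      (0 < n)%N ->
      (num_copies H G <= t)%N ->
      decides_triangle G p t
        (C%:R * time_bound R H n t * (1 + ln n%:R) ^+ c)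
        (C%:R / n%:R).
Proof.
have [l [neq cardH few]] := nice_steps Hnice.
pose k := size (nonempty_steps l); pose c := (3 * k + 2)%N.
pose K := (40 + 34 * (2 ^ size l) ^ 2 + 2 * level_const k)%N.
exists (Main l), (K * 2 ^ c)%N, c => G t n n_gt0 copies.
have [B [HB total]] := total_cost_bound R l t n_gt0.
apply: ok_decides.
- apply: (ok_main n_gt0 neq _ HB) => tau tri.
  exact: leq_trans (few _ _ tri) copies.
- apply: le_trans total _.
  have -> : time_bound R H n t = time_triangle_free (size l)%:R n%:R t%:R.
    rewrite /time_bound cardH; case: (has_triangle H) => /=; last by rewrite addn0.
    exact: time_triangle_shift.
  have tm0 : 0 <= time_triangle_free (size l)%:R n%:R t%:R :> R.
    by rewrite addr_ge0 ?mulr_ge0 ?powR_ge0.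
  have bits_ln : (bits n)%:R ^+ c <= 2 ^+ c * (1 + ln n%:R) ^+ c :> R.
    rewrite -exprMn lerXn2r ?nnegrE ?mulr_ge0 ?addr_ge0 ?ln_ge0 ?ler1n //.
    exact: bits_le_ln.
  rewrite -/k -/K -/c natrM natrX [leRHS]mulrAC ler_wpM2r // -mulrA ler_wpM2l //.
- rewrite ler_pdivlMr ?ltr0n // mulVf ?pnatr_eq0 -?lt0n // ler1n muln_gt0 expn_gt0.
  by rewrite /K.
- by rewrite divr_ge0.
Qed.
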